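(* Let $a,b,c$ be positive numbers with $a<b<c$. The following are equivalent: (i) $\mathcal G(\chi_{[0,c)},a\mathbb Z\times\mathbb Z/b)$ is a Gabor frame; (ii) for every $t\in\mathbb R$, the only vector $\mathbf z$ with entries in $\{-1,0,1\}$ (indexed by $b\mathbb Z$) satisfying $\mathbf M_{a,b,c}(t)\mathbf z=0$ is $\mathbf z=0$; (iii) $\mathcal D_{a,b,c}=\emptyset$.
   Context: Gabor system: $\mathcal G(\phi,a\mathbb Z\times\mathbb Z/b)=\{e^{-2\pi i n t/b}\phi(t-ma):(m,n)\in\mathbb Z^2\}$; a Gabor frame is such a system that is a frame for $L^2(\mathbb R)$ (there are $0<A\le B<\infty$ with $A\|f\|_2^2\le\sum_{\psi}|\langle f,\psi\rangle|^2\le B\|f\|_2^2$ for all $f$). For $a,b,c>0$ and $t\in\mathbb R$, $\mathbf M_{a,b,c}(t)=(\chi_{[0,c)}(t-\mu+\lambda))_{\mu\in a\mathbb Z,\lambda\in b\mathbb Z}$ is the infinite matrix with rows indexed by $a\mathbb Z$ and columns by $b\mathbb Z$, acting by $(\mathbf M_{a,b,c}(t)\mathbf x)(\mu)=\sum_{\lambda\in b\mathbb Z}\chi_{[0,c)}(t-\mu+\lambda)\mathbf x(\lambda)$. $\mathcal B_b$ is the set of vectors $(\mathbf x(\lambda))_{\lambda\in b\mathbb Z}$ with entries in $\{0,1\}$, and $\mathcal B_b^0=\{\mathbf x\in\mathcal B_b:\mathbf x(0)=1\}$. $\mathbf 1$, $\mathbf 2$ denote the vectors indexed by $a\mathbb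 Z$ all of whose entries are $1$, resp. $2$. $\mathcal D_{a,b,c}=\{t\in\mathbb R:\mathbf M_{a,b,c}(t)\mathbf x=\mathbf 2\text{ for some }\mathbf x\in\mathcal B_b^0\}$. *)

(* Defs.v *)
From HB Require Import structures.
From mathcomp Require Import all_boot all_order all_algebra.
From mathcomp Require Import all_classical all_reals all_analysis.
Set Implicit Arguments. Unset Strict Implicit. Unset Printing Implicit Defensive.
Import Order.TTheory GRing.Theory Num.Theory.
Local Open Scope classical_set_scope.
Local Open Scope ring_scope.

Section Gabor.
Variable R : realType.
Local Notation mu := (@lebesgue_measure R).

Definition chi (c : R) (s : R) : R := if (0 <= s) && (s < c) then 1 else 0.

(* A real-valued measurable square-integrable function. A complex-valued
   f in L^2(R) is represented as f = u + i v with u, v real in L^2. *)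
Definition L2real (u : R -> R) : Prop :=
  measurable_fun setT u /\ mu.-integrable setT (fun x => ((u x) ^+ 2)%:E).

Definition L2norm2 (u v : R -> R) : R :=
  Rintegral mu setT (fun x => u x ^+ 2 + v x ^+ 2).

(* Gabor atom  psi_{m,n}(t) = e^{-2 pi i n t / b} phi(t - m a), real window phi.
   <u + i v, psi_{m,n}> = \int (u + i v)(t) (cos th + i sin th) phi(t - m a) dt,
   th = 2 pi n t / b. Real and imaginary parts: *)
Definition gabor_re (phi : R -> R) (a b : R) (u v : R -> R) (m n : int) : R :=
  Rintegral mu setT (fun t =>
    phi (t - m%:~R * a) *
    (u t * cos (2 * pi * n%:~R * t / b) - v t * sin (2 * pi * n%:~R * t / b))).

Definition gabor_im (phi : R -> R) (a b : R) (u v : R -> R) (m n : int) : R :=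
  Rintegral mu setT (fun t =>
    phi (t - m%:~R * a) *
    (u t * sin (2 * pi * n%:~R * t / b) + v t * cos (2 * pi * n%:~R * t / b))).

Definition gabor_frame (phi : R -> R) (a b : R) : Prop :=
  exists A B : R, 0 < A /\ A <= B /\
    forall u v : R -> R, L2real u -> L2real v ->
      ((A * L2norm2 u v)%:E <=
         \esum_(mn in [set: int * int])
           ((gabor_re phi a b u v mn.1 mn.2) ^+ 2
            + (gabor_im phi a b u v mn.1 mn.2) ^+ 2)%:E)%E /\
      (\esum_(mn in [set: int * int])
           ((gabor_re phi a b u v mn.1 mn.2) ^+ 2
            + (gabor_im phi a b u v mn.1 mn.2) ^+ 2)%:E
         <= (B * L2norm2 u v)%:E)%E.

(* (M_{a,b,c}(t) x)(mu) with mu = j a, columns lambda = k b indexed by k : int.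
   The sum has finitely many nonzero terms (b > 0). *)
Definition Mmul (a b c t : R) (x : int -> R) (j : int) : R :=
  \sum_(k \in [set: int]) chi c (t - j%:~R * a + k%:~R * b) * x k.

Definition Dset (a b c : R) : set R :=
  [set t | exists x : int -> R,
     (forall k, x k = 0 \/ x k = 1) /\ x 0%Z = 1 /\
     (forall j, Mmul a b c t x j = 2)].

End Gabor.

(* Main.v *)
Require Import Defs.
From HB Require Import structures.
From mathcomp Require Import all_boot all_order all_algebra.
From mathcomp Require Import all_classical all_reals all_analysis.
From mathcomp Require Import measurable_realfun ring lra zify.
Set Implicit Arguments. Unset Strict Implicit. Unset Printing Implicit Defensive.
Import Order.TTheory GRing.Theory Num.Theory.
Import numFieldNormedType.Exports.
Local Open Scope classical_set_scope.
Local Open Scope ring_scope.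

(** Row [j] of [M_{a,b,c}(t)] sums a sequence over the window of indices [k] with
    [j a <= t + k b < j a + c].  Since [a < b], going from one row to the next
    drops at most one index and adds at most one, so a null vector takes equal
    values at a dropped and an added index, and vanishes at an unmatched one.
    Hence every function of a null vector that fixes [0] has constant row sums.
    For [{-1, 0, 1}]-valued null vectors this gives 0/1 vectors with row sums [N];
    keeping every [N]-th element of the support brings the row sums down to [1],
    and two disjoint such vectors add up to a solution of [M x = 2].

    If null vectors are trivial, then a compactness argument (ultralimits; a limit
    of times from the left is handled by the reflection [t -> c - t]) shows that
    finitely many rows around [x 0] already determine [x 0], and since only
    finitely many finite 0/1 matrices occur, [x 0 ^ 2] is bounded by a constant
    times finitely many squared rows, uniformly in [t].  Parseval's inequality on
    a period [b] turns the rows of [k |-> f (t + k b)] into Gabor coefficients,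
    which yields the lower frame bound; Bessel's inequality yields the upper one.
    Conversely, a nonzero null vector has infinitely many nonzero entries, and its
    truncations, spread over short cells, have bounded Gabor sums but unbounded
    norms. *)

(** * Windows and null vectors *)

(** The hypothesis on null vectors is qualitative: it concerns entries [-1, 0, 1] and all rows at
    once. A lower frame bound concerns arbitrary real samples and needs a constant. Real null
    vectors can be rescaled or grow, so they have no useful limits. The 0/1 vectors cut out of their
    positive and negative parts live in a compact space, and a row sum [1] survives any limit and
    keeps it nonzero. This works already for a vector that is null on a range of consecutive rows
    only. The windows are half-open, hence continuous in [t] from one side only; from the other side
    the limit windows are closed at the opposite end, which is why a reflection appears. Since
    [b < c], a window is longer than a period of the exponentials: upper estimates use an orthogonal
    system on several periods, lower estimates fold the line onto one period, where the system is
    complete. Only real functions are treated; a complex [u + i v] decouples once the frequencies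
    [n] and [- n] are paired. *)

(* Row sums of [x] telescope along [X]. *)
Definition primitive (V : zmodType) (x X : int -> V) :=
  forall k, X (k + 1) = X k + x k.

Lemma primitive_sum (V : zmodType) (x X : int -> V) : primitive x X ->
  forall l n, \sum_(i < n) x (l + i%:Z) = X (l + n%:Z) - X l.
Proof.
move=> px l; elim=> [|n IH]; first by rewrite big_ord0 addr0 subrr.
rewrite big_ord_recr /= IH; have -> : l + n.+1%:Z = l + n%:Z + 1 by lia.
by rewrite px addrAC.
Qed.

Lemma primitive_exists (V : zmodType) (x : int -> V) : exists X, primitive x X.
Proof.
exists (fun k => match k with Posz n => \sum_(i < n) x i%:Z
                 | Negz n => - \sum_(i < n.+1) x (Negz i) end).
case=> [n|[|n]].
- by rewrite -[Posz n + 1]/(Posz (n + 1)) addn1 big_ord_recr.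
- have -> : Negz 0 + 1 = 0 by [].
  by rewrite /= big_ord0 big_ord1 addNr.
have -> : Negz n.+1 + 1 = Negz n by lia.
by rewrite [in RHS]big_ord_recr /= opprD addrNK.
Qed.

Lemma ceil_step (R : realType) (x y : R) : x <= y -> y < x + 1 ->
  Num.ceil y = Num.ceil x \/ Num.ceil y = Num.ceil x + 1.
Proof.
move=> xy yx; have h1 := le_ceil xy.
have h2 : Num.ceil y <= Num.ceil x + 1.
  rewrite ceil_le_int rmorphD /=; have := ceil_ge x; move: yx; rewrite /=; lra.
by lia.
Qed.

(** Ranges of rows: all of [int] for the equivalence with [Dset], and [|j| <= K] for the local
    version. Convexity allows comparing two rows by unit steps inside the range. *)
Definition int_convex (P : int -> Prop) :=
  forall i j k : int, i <= j -> j <= k -> P i -> P k -> P j.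

Section Windows.
Variables (R : realType) (a b c : R).
Hypotheses (a_gt0 : 0 < a) (ltab : a < b) (ltbc : b < c).

Definition win_lo (t : R) (j : int) : int := Num.ceil ((j%:~R * a - t) / b).
Definition win_hi (t : R) (j : int) : int := Num.ceil ((j%:~R * a + c - t) / b).

Let b_gt0 : 0 < b. Proof. exact: lt_trans ltab. Qed.

Lemma chi_window t j k :
  chi c (t - j%:~R * a + k%:~R * b) = ((win_lo t j <= k < win_hi t j)%R : bool)%:R.
Proof.
rewrite /chi /win_lo /win_hi ceil_le_int ceil_gt_int ler_pdivrMr // ltr_pdivlMr //.
have -> : (0 <= t - j%:~R * a + k%:~R * b) = (j%:~R * a - t <= k%:~R * b).
  by apply/idP/idP => h; lra.
have -> : (t - j%:~R * a + k%:~R * b < c) = (k%:~R * b < j%:~R * a + c - t).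
  by apply/idP/idP => h; lra.
by case: ifP.
Qed.

Lemma win_lo_le_hi t j : win_lo t j <= win_hi t j.
Proof.
apply: le_ceil; rewrite ler_pM2r ?invr_gt0 //; have := ltbc; have := b_gt0.
by lra.
Qed.

Lemma win_lo_step t j :
  win_lo t (j + 1) = win_lo t j \/ win_lo t (j + 1) = win_lo t j + 1.
Proof.
apply: ceil_step; rewrite rmorphD /=.
  by rewrite ler_pM2r ?invr_gt0 //; have := a_gt0; lra.
rewrite -ltrBlDl -mulrBl ltr_pdivrMr //; have := ltab; lra.
Qed.

Lemma win_hi_step t j :
  win_hi t (j + 1) = win_hi t j \/ win_hi t (j + 1) = win_hi t j + 1.
Proof.
apply: ceil_step; rewrite rmorphD /=.
  by rewrite ler_pM2r ?invr_gt0 //; have := a_gt0; lra.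
rewrite -ltrBlDl -mulrBl ltr_pdivrMr //; have := ltab; lra.
Qed.

Lemma Mmul_sum t (x : int -> R) j :
  Mmul a b c t x j =
  \sum_(i < `|win_hi t j - win_lo t j|%N) x (win_lo t j + i%:Z).
Proof.
set n := absz _; set l := win_lo t j.
have nE : n%:Z = win_hi t j - l by have := win_lo_le_hi t j; rewrite /n /l; lia.
pose s := [seq l + i%:Z | i <- index_iota 0 n].
have us : uniq s by rewrite map_inj_uniq ?iota_uniq // => p q; lia.
rewrite /Mmul -(@fsbig_widen _ _ _ _ [set` s]) //; last first.
  move=> k [_ /= ks]; rewrite chi_window; case: (boolP (_ <= _ < _)) => [/andP[h1 h2]|_].
    case: ks; apply/mapP; exists `|k - l|%N; last by rewrite /l in nE *; lia.
    by rewrite mem_index_iota; rewrite -/l in h1; lia.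
  by rewrite mul0r.
rewrite -fsbig_seq // big_map big_mkord.
apply: eq_bigr => i _; rewrite chi_window -/l.
suff -> : (l <= l + i%:Z < win_hi t j)%R by rewrite mul1r.
by have := ltn_ord i; lia.
Qed.

Lemma Mmul_shift t (x : int -> R) j i k :
  Mmul a b c (t + k%:~R * b - i%:~R * a) (fun l => x (k + l)) j =
  Mmul a b c t x (i + j).
Proof.
have [Elo Ehi] : win_lo (t + k%:~R * b - i%:~R * a) j = win_lo t (i + j) - k /\
  win_hi (t + k%:~R * b - i%:~R * a) j = win_hi t (i + j) - k.
  suff A (y z : R) : y = z - k%:~R -> Num.ceil y = Num.ceil z - k.
    by split; apply: A; rewrite rmorphD /=; field; rewrite gt_eqF.
  by move=> ->; rewrite -rmorphN /= ceilDrz ?intr_int // intrKceil.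
rewrite !Mmul_sum Elo Ehi.
have -> : win_hi t (i + j) - k - (win_lo t (i + j) - k)
  = win_hi t (i + j) - win_lo t (i + j) by lia.
by apply: eq_bigr => l _; rewrite addrA [k + _]addrC subrK.
Qed.

Lemma Mmul_primitive t x X j : primitive x X ->
  Mmul a b c t x j = X (win_hi t j) - X (win_lo t j).
Proof.
move=> px; rewrite Mmul_sum (primitive_sum px); congr (X _ - X _).
by have := win_lo_le_hi t j; lia.
Qed.

Definition rowsum (V : zmodType) (X : int -> V) t j :=
  X (win_hi t j) - X (win_lo t j).

(* Moving the window by one step loses at most one index and gains at most one. *)
Lemma rowsum_comp_step (V W : zmodType) (x X : int -> V) (h : V -> W) H t j :
  primitive x X -> primitive (h \o x) H -> h 0 = 0 ->
  rowsum X t (j + 1) = rowsum X t j -> rowsum H t (j + 1) = rowsum H t j.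
Proof.
move=> px pH h0; rewrite /rowsum.
have cancel (U : zmodType) (p q r s : U) : (p + r - (q + s) == p - q) = (r == s).
  by rewrite opprD addrACA -[X in _ == X]addr0 (inj_eq (addrI _)) subr_eq0.
move=> /eqP E; apply/eqP; move: E.
case: (win_lo_step t j) => ->; case: (win_hi_step t j) => ->; rewrite ?px ?pH //=.
- have := cancel V (X (win_hi t j)) (X (win_lo t j)) (x (win_hi t j)) 0.
  have := cancel W (H (win_hi t j)) (H (win_lo t j)) (h (x (win_hi t j))) 0.
  by rewrite !addr0 => -> -> /eqP ->; rewrite h0.
- have := cancel V (X (win_hi t j)) (X (win_lo t j)) 0 (x (win_lo t j)).
  have := cancel W (H (win_hi t j)) (H (win_lo t j)) 0 (h (x (win_lo t j))).
  by rewrite !addr0 => -> -> /eqP <-; rewrite h0.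
by rewrite !cancel => /eqP ->.
Qed.

Lemma rowsum_comp (V W : zmodType) (x X : int -> V) (h : V -> W) H t
    (P : int -> Prop) r : int_convex P ->
  primitive x X -> primitive (h \o x) H -> h 0 = 0 ->
  (forall j, P j -> rowsum X t j = r) ->
  forall i j, P i -> P j -> rowsum H t i = rowsum H t j.
Proof.
move=> cP px pH h0 Xr.
have up i n : P i -> P (i + n%:Z) -> rowsum H t (i + n%:Z) = rowsum H t i.
  move=> Pi; elim: n => [|n IH] Pn; first by rewrite addr0.
  have Pn' : P (i + n%:Z) by apply: cP Pi Pn; lia.
  rewrite -(IH Pn'); have E : i + n.+1%:Z = i + n%:Z + 1 by lia.
  by rewrite E; apply: (rowsum_comp_step px pH h0); rewrite -E !Xr.
move=> i j Pi Pj; case: (leP i j) => ij.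
  have E : j = i + `|j - i|%N by lia.
  by rewrite E up // -E.
have E : i = j + `|i - j|%N by lia.
by rewrite {1}E up // -E.
Qed.

Lemma Mmul_bool t (e : int -> bool) C j :
  primitive (fun k => (e k : nat)%:Z) C ->
  Mmul a b c t (fun k => (e k)%:R) j = (rowsum C t j)%:~R.
Proof.
move=> pC; rewrite (@Mmul_primitive _ _ (fun k => (C k)%:~R)) ?rmorphB //.
by move=> k; rewrite pC rmorphD.
Qed.

(* Keep every N-th element of the support: a window holding exactly N consecutive
   elements of the support keeps exactly one. *)
Lemma thinning t (e : int -> bool) (N : nat) (P : int -> Prop) : (0 < N)%N ->
  (forall j, P j -> Mmul a b c t (fun k => (e k)%:R) j = N%:R) ->
  exists w : int -> bool, (forall k, w k -> e k) /\
    forall j, P j -> Mmul a b c t (fun k => (w k)%:R) j = 1.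
Proof.
move=> N0 eN; have [C pC] := primitive_exists (fun k => (e k : nat)%:Z).
(* [C] counts the support, and an index is kept when the count reaches a multiple of [N]. So
   [C %/ N] is a primitive of the thinned vector, and it grows by exactly 1 when [C] grows by
   [N]. *)
exists (fun k => (C (k + 1)%R %/ N)%Z != (C k %/ N)%Z); split.
  move=> k; rewrite pC; case: (e k) => //; by rewrite addr0 eqxx.
move=> j Pj; rewrite (@Mmul_bool _ _ (fun k => (C k %/ N)%Z)).
  have := eN j Pj; rewrite (Mmul_bool _ _ pC) [X in _ = X]pmulrn => /eqP.
  rewrite eqr_int /rowsum => /eqP CN.
  have -> : C (win_hi t j) = 1 * N%:Z + C (win_lo t j) by rewrite mul1r -CN subrK.
  by rewrite divzMDl ?addrK //; lia.
move=> k; rewrite pC; case: (e k) => /=; last by rewrite addr0 eqxx addr0.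
have N0' : (0 < N%:Z) by lia.
have h1 := divz_eq (C k + 1) N; have h2 := divz_eq (C k) N.
have h3 := modz_ge0 (C k) (lt0r_neq0 N0'); have h4 := ltz_pmod (C k) N0'.
have h5 := modz_ge0 (C k + 1) (lt0r_neq0 N0'); have h6 := ltz_pmod (C k + 1) N0'.
by case: eqP => [->|ne] /=; rewrite ?addr0 //; nia.
Qed.

Lemma Mmul_opp t x j : Mmul a b c t (fun k => - x k) j = - Mmul a b c t x j.
Proof. by rewrite !Mmul_sum sumrN. Qed.

Lemma MmulD t x y j :
  Mmul a b c t (fun k => x k + y k) j = Mmul a b c t x j + Mmul a b c t y j.
Proof. by rewrite !Mmul_sum big_split. Qed.

(** The indicator of the positive entries has the same sum [N] in every row of the range. If [N]
    were 0, row [j0] would consist of entries [<= 0] with sum 0, against [x k0 != 0]; so thinning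
    applies. *)
Lemma Mmul_positive_part t x (P : int -> Prop) j0 k0 : int_convex P ->
  (forall j, P j -> Mmul a b c t x j = 0) -> P j0 ->
  win_lo t j0 <= k0 < win_hi t j0 -> x k0 != 0 ->
  exists w : int -> bool, (forall k, w k -> 0 < x k) /\
    forall j, P j -> Mmul a b c t (fun k => (w k)%:R) j = 1.
Proof.
move=> cP x0 Pj0 k0w xk0.
have [X pX] := primitive_exists x.
pose e k := 0 < x k.
have [C pC] := primitive_exists (fun k => (e k : nat)%:Z).
pose N := (\sum_(i < `|win_hi t j0 - win_lo t j0|) e (win_lo t j0 + i%:Z)%R)%N.
have NE : Mmul a b c t (fun k => (e k)%:R) j0 = N%:R.
  by rewrite Mmul_sum /N natr_sum.
have eN j : P j -> Mmul a b c t (fun k => (e k)%:R) j = N%:R.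
  move=> Pj; rewrite -NE !(Mmul_bool _ _ pC); congr _%:~R.
  apply: (@rowsum_comp _ _ x X (fun y : R => ((0 < y)%R : nat)%:Z) C t P 0 cP pX pC _ _ j j0 Pj Pj0).
    by rewrite ltxx.
  by move=> i Pi; rewrite -(x0 i Pi) (Mmul_primitive _ _ pX).
apply: thinning eN; rewrite lt0n; apply/eqP => N0.
have/forallP npos : [forall i : 'I_(`|win_hi t j0 - win_lo t j0|), ~~ e (win_lo t j0 + i%:Z)].
  apply/forallP => i; move/eqP: N0; rewrite sum_nat_eq0 => /forallP/(_ i) /=.
  by case: (e _).
have := x0 j0 Pj0; rewrite Mmul_sum => /eqP; rewrite -oppr_eq0 -sumrN psumr_eq0; last first.
  by move=> i _; rewrite oppr_ge0 leNgt npos.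
have lt : (`|k0 - win_lo t j0| < `|win_hi t j0 - win_lo t j0|)%N by lia.
move=> /allP/(_ (Ordinal lt)); rewrite mem_index_enum => /(_ isT) /=.
rewrite oppr_eq0; have -> : win_lo t j0 + `|k0 - win_lo t j0|%N = k0 by lia.
by rewrite (negbTE xk0).
Qed.

Lemma Mmul_split t x (P : int -> Prop) j0 k0 : int_convex P ->
  (forall j, P j -> Mmul a b c t x j = 0) -> P j0 ->
  win_lo t j0 <= k0 < win_hi t j0 -> x k0 != 0 ->
  exists w1 w2 : int -> bool, (forall k, ~~ (w1 k && w2 k)) /\
    forall j, P j -> Mmul a b c t (fun k => (w1 k)%:R) j = 1 /\
                     Mmul a b c t (fun k => (w2 k)%:R) j = 1.
Proof.
move=> cP x0 Pj0 k0w xk0.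
have [w1 [w1x w1M]] := Mmul_positive_part cP x0 Pj0 k0w xk0.
have x0' j : P j -> Mmul a b c t (fun k => - x k) j = 0.
  by move=> Pj; rewrite Mmul_opp x0 // oppr0.
have xk0' : - x k0 != 0 by rewrite oppr_eq0.
have [w2 [w2x w2M]] := Mmul_positive_part cP x0' Pj0 k0w xk0'.
exists w1, w2; split; last by move=> j Pj; rewrite w1M ?w2M.
by move=> k; apply/negP => /andP[/w1x h1 /w2x]; lra.
Qed.

Lemma index_in_window t k : exists j, win_lo t j <= k < win_hi t j.
Proof.
exists (Num.floor ((t + k%:~R * b) / a)); set f := Num.floor _.
have := floor_itv ((t + k%:~R * b) / a); rewrite -/f rmorphD /=.
rewrite ler_pdivlMr // ltr_pdivrMr // mulrDl mul1r => /andP[h1 h2].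
rewrite /win_lo /win_hi ceil_le_int ceil_gt_int ler_pdivrMr // ltr_pdivlMr //.
by apply/andP; split; have := ltab; have := ltbc; lra.
Qed.

Definition null_trivial := forall (t : R) (z : int -> R),
  (forall k, z k = -1 \/ z k = 0 \/ z k = 1) ->
  (forall j, Mmul a b c t z j = 0) -> forall k, z k = 0.

(** From a solution of [M x = 2], thinning by 2 keeps a [w] with row sums 1, and [2 w - x] is null
    with value [1] or [-1] at 0. Conversely, the two disjoint vectors split off a null vector add up
    to a 0/1 vector with row sums 2, and a shift in time brings a point of its support to 0. *)
Lemma null_trivial_Dset0 : null_trivial <-> Dset a b c = set0.
Proof.
split=> [H|D0 t z zT z0 k].
  apply/seteqP; split=> // t [x [x01 [x1 x2]]].
  pose e k := x k == 1.
  have xe k : x k = (e k)%:R.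
    by rewrite /e; case: (x01 k) => ->; rewrite ?eqxx // eq_sym oner_eq0.
  have [|w [we w1]] := @thinning t e 2 (fun _ => True) isT.
    by move=> j _; rewrite -(x2 j); congr Mmul; apply/funext => k; rewrite xe.
  have := H t (fun k => (w k)%:R + (w k)%:R + - x k) _ _ 0.
  rewrite x1 => F; suff : (w 0)%:R + (w 0)%:R + -1 = 0 :> R by case: (w 0) => /= h; lra.
  apply: F => [l|j].
    rewrite xe; case: (boolP (w l)) => [/we ->|_]; first by right; right => /=; lra.
    by case: (e l); [left|right; left] => /=; lra.
  by rewrite MmulD Mmul_opp MmulD w1 // x2; lra.
have {}D0 s : ~ Dset a b c s by rewrite D0.
apply: contrapT => /eqP zk.
have [j0 kw] := index_in_window t k.
have cT : int_convex (fun _ => True) by [].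
have [//|w1 [w2 [dis ww]]] := @Mmul_split t z (fun _ => True) j0 k cT (fun j _ => z0 j) I kw.
have : exists l, w1 l.
  apply: contrapT => nw; have := (ww 0 I).1; rewrite Mmul_sum big1; first by move/eqP; rewrite eq_sym oner_eq0.
  by move=> i _; case: (boolP (w1 _)) => // h; case: nw; eexists; exact: h.
case=> l w1l; apply: (D0 (t + l%:~R * b)).
exists (fun i => (w1 (l + i))%:R + (w2 (l + i))%:R); split.
  by move=> i; have := dis (l + i); case: (w1 _); case: (w2 _) => // _; [right|right|left] => /=; lra.
split; first by have := dis l; rewrite addr0 w1l; case: (w2 l) => //= _; rewrite addr0.
move=> j; have := @Mmul_shift t (fun i => (w1 i)%:R + (w2 i)%:R) j 0 l.
rewrite mul0r subr0 add0r => ->; rewrite MmulD.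
by have [-> ->] := ww j I; lra.
Qed.

End Windows.

(** * Local stability *)

Section FiniteBounds.
Variable R : realType.

Lemma sqr_sum_le n (f : 'I_n -> R) :
  (\sum_i f i) ^+ 2 <= n%:R * \sum_i f i ^+ 2.
Proof.
elim: n f => [|n IH] f; first by rewrite !big_ord0 mul0r expr0n.
rewrite !big_ord_recr /=.
have {IH} := IH (fun i => f (widen_ord (leqnSn n) i)).
have : 0 <= \sum_(i < n) f (widen_ord (leqnSn n) i) ^+ 2.
  by apply: sumr_ge0 => i _; exact: sqr_ge0.
set Q := \sum_(i < n) _; set S := \sum_(i < n) _; set x := f ord_max => Q0 SQ.
rewrite -natr1; case: n => [|n] in f Q S x Q0 SQ *.
  by rewrite /S /Q !big_ord0 !add0r mul1r.
have n0 : 0 < n.+1%:R :> R by [].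
move: n.+1%:R n0 SQ => m m0 SQ.
have h : 0 <= (S - m * x) ^+ 2 by exact: sqr_ge0.
have h2 : 0 <= Q - (2 * S * x - m * x ^+ 2).
  rewrite -(pmulr_rge0 _ m0).
  have -> : m * (Q - (2 * S * x - m * x ^+ 2)) = m * Q - S ^+ 2 + (S - m * x) ^+ 2 by ring.
  by apply: addr_ge0; [rewrite subr_ge0; exact: SQ|exact: h].
rewrite -subr_ge0.
have -> : (m + 1) * (Q + x ^+ 2) - (S + x) ^+ 2 =
  (m * Q - S ^+ 2) + (Q - (2 * S * x - m * x ^+ 2)) by ring.
by apply: addr_ge0; [rewrite subr_ge0; exact: SQ|exact: h2].
Qed.

Lemma cauchy_sum n (f g : 'I_n -> R) :
  (\sum_i f i * g i) ^+ 2 <= n%:R * (\sum_i f i ^+ 2) * \sum_i g i ^+ 2.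
Proof.
apply: le_trans (sqr_sum_le _) _; rewrite -mulrA ler_wpM2l //.
rewrite mulr_sumr ler_sum // => i _; rewrite exprMn ler_wpM2r ?sqr_ge0 //.
by rewrite (bigD1 i) //= lerDl sumr_ge0 // => j _; exact: sqr_ge0.
Qed.

(** A coordinate that vanishes on the kernel of a matrix is a combination [y] of its rows, which
    gives the constant [m * sum y ^ 2] for this matrix. There are finitely many boolean matrices of
    a given size, so the sum of their constants serves all of them. *)
Lemma boolmx_coord_bound m n (i0 : 'I_n) : exists C : R, 0 <= C /\
  forall B : 'M[bool]_(m, n),
  (forall x : 'cV[R]_n, map_mx (fun e : bool => e%:R) B *m x = 0 -> x i0 0 = 0) ->
  forall x : 'cV[R]_n, (x i0 0) ^+ 2 <=
    C * \sum_j ((map_mx (fun e : bool => e%:R) B *m x) j 0) ^+ 2.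
Proof.
have H (B : 'M[bool]_(m, n)) : exists C : R, 0 <= C /\
  ((forall x : 'cV[R]_n, map_mx (fun e : bool => e%:R) B *m x = 0 -> x i0 0 = 0) ->
  forall x : 'cV[R]_n, (x i0 0) ^+ 2 <=
    C * \sum_j ((map_mx (fun e : bool => e%:R) B *m x) j 0) ^+ 2).
  set A := map_mx _ B.
  have [ker|nker] := pselect (forall x : 'cV[R]_n, A *m x = 0 -> x i0 0 = 0); last first.
    by exists 0.
  (* Membership in the row space is tested against the columns of [cokermx A], which lie in the
     kernel of [A]. *)
  have : ((delta_mx 0 i0 : 'rV[R]_n) <= A)%MS.
    rewrite submxE; apply/eqP/matrixP => p q; rewrite [RHS]mxE.
    have := ker (col q (cokermx A)).
    rewrite -rowE !mxE; apply.
    by rewrite colE mulmxA mulmx_coker mul0mx.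
  case/submxP => y yA; exists (m%:R * \sum_j y 0 j ^+ 2); split.
    by rewrite mulr_ge0 // sumr_ge0 // => j _; exact: sqr_ge0.
  move=> _ x; have -> : x i0 0 = \sum_j y 0 j * (A *m x) j 0.
    transitivity (((delta_mx 0 i0 : 'rV[R]_n) *m x) 0 0); first by rewrite -rowE mxE.
    by rewrite yA -mulmxA mxE.
  exact: cauchy_sum.
have [Cf Cfp] := choice H.
exists (\sum_B Cf B); split; first by apply: sumr_ge0 => B _; exact: (Cfp B).1.
move=> B ker x; apply: le_trans ((Cfp B).2 ker x) _; rewrite ler_wpM2r //.
  by apply: sumr_ge0 => j _; exact: sqr_ge0.
by rewrite (bigD1 B) //= lerDl sumr_ge0 // => B' _; exact: (Cfp B').1.
Qed.

End FiniteBounds.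

(** * Limits along an ultrafilter *)

Section Ultralimits.
Variable R : realType.
Variable U : set_system nat.
Hypothesis UU : UltraFilter U.

Lemma ultra_ex (A : set nat) : U A -> exists n, A n.
Proof. exact: (@filter_ex _ U (ultra_proper (F := U))). Qed.

Lemma ultraI (A B : set nat) : U A -> U B -> U (A `&` B).
Proof. exact: (@filterI _ U _). Qed.

Lemma ultraS (A B : set nat) : A `<=` B -> U A -> U B.
Proof. exact: (@filterS _ U _). Qed.

Lemma ultra_forall_ord n (A : 'I_n -> set nat) :
  (forall i, U (A i)) -> U [set m | forall i, A i m].
Proof.
elim: n A => [|n IH] A UA; first by apply: ultraS (@filterT _ U _) => m _ [].
have := ultraI (IH (fun i => A (lift ord0 i)) (fun i => UA _)) (UA ord0).
apply: ultraS => m [/= h1 h2] i; case: (unliftP ord0 i) => [j ->|->] //.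
Qed.

Lemma ultra_bool (w : nat -> bool) : exists v, U [set m | w m = v].
Proof.
case: (@in_ultra_setVsetC _ U [set m | w m = true] UU) => h; first by exists true.
exists false; apply: ultraS h => m /=; by case: (w m).
Qed.

(** The limit is the supremum of the [s] that stay below [u] along [U]; as [U] is an ultrafilter,
    [u] stays below every larger number along [U]. *)
Lemma ultra_real (u : nat -> R) (p q : R) : (forall n, p <= u n <= q) ->
  exists l, p <= l <= q /\ forall e, 0 < e -> U [set m | l - e < u m < l + e].
Proof.
move=> upq; pose S := [set s : R | U [set m | s <= u m]].
have Sp : S p by apply: ultraS (@filterT _ U _) => m _ /=; case/andP: (upq m).
have Sq s : S s -> s <= q.
  by move=> /ultra_ex[m /= sm]; apply: le_trans sm _; case/andP: (upq m).
have hS : has_sup S by split; [exists p|exists q => s; exact: Sq].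
exists (sup S); split.
  rewrite (ub_le_sup hS.2 Sp) /=; apply: ge_sup; [exact: hS.1|by move=> s /Sq].
move=> e e0; have [s Ss ls] := sup_adherent e0 hS.
have nS : ~ S (sup S + e).
  by move=> /(ub_le_sup hS.2); rewrite leNgt ltrDl e0.
case: (@in_ultra_setVsetC _ U [set m | sup S + e <= u m] UU) => // h.
apply: ultraS (ultraI Ss h) => m [/= h1 /negP]; rewrite -ltNge => h2.
by rewrite h2 (lt_le_trans ls h1).
Qed.

End Ultralimits.

(** * Compactness and a bound uniform in time *)

Section LocalStability.
Variables (R : realType) (a b c : R).
Hypotheses (a_gt0 : 0 < a) (ltab : a < b) (ltbc : b < c).
Let b_gt0 : 0 < b. Proof. exact: lt_trans ltab. Qed.
Local Notation lo := (win_lo a b).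
Local Notation hi := (win_hi a b c).

Lemma ceil_left_const (y : R) :
  exists2 e, 0 < e & forall z, y - e < z -> z <= y -> Num.ceil z = Num.ceil y.
Proof.
have := ceil_itv y; rewrite rmorphB /= => /andP[h1 h2].
exists (y - ((Num.ceil y)%:~R - 1)); first by lra.
move=> z zy yz; apply: ceil_def; rewrite rmorphB /=; apply/andP; split; lra.
Qed.

(** The value [floor y + 1] differs from [ceil y] exactly when [y] is an integer; this failure of
    right continuity is what the reflection has to repair. *)
Lemma ceil_right_const (y : R) :
  exists2 e, 0 < e & forall z, y < z -> z < y + e -> Num.ceil z = Num.floor y + 1.
Proof.
have := floor_itv y; rewrite rmorphD /= => /andP[h1 h2].
exists ((Num.floor y)%:~R + 1 - y); first by lra.
move=> z zy yz; apply: ceil_def; rewrite addrK rmorphD /=; apply/andP; split; lra.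
Qed.

(* Along a convergent ultralimit of times the windows stabilise, either to the
   windows of the limit or, when approached from the left, to those of its
   reflection [c - t]. *)
Lemma ultra_windows (U : set_system nat) (UU : UltraFilter U) (u : nat -> R) :
  (forall n, 0 <= u n <= a) -> exists l h : int -> int,
  (forall j, U [set m | lo (u m) j = l j /\ hi (u m) j = h j]) /\
  (exists t, (forall j, l j = lo t j /\ h j = hi t j) \/
    (forall j, l j = 1 - hi t (- j) /\ h j = 1 - lo t (- j))).
Proof.
move=> u0a; have [t [t0a tl]] := ultra_real UU u0a.
have bV : 0 < b^-1 by rewrite invr_gt0.
(* The arguments of the ceilings decrease in the time, so times [>= t] approach their limits from
   the left, where the ceiling is continuous. *)
case: (@in_ultra_setVsetC _ U [set m | t <= u m] UU) => side.
  exists (lo t), (hi t); split; last by exists t; left.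
  move=> j; have [e1 e10 H1] := ceil_left_const ((j%:~R * a - t) / b).
  have [e2 e20 H2] := ceil_left_const ((j%:~R * a + c - t) / b).
  apply: ultraS (ultraI UU side (ultraI UU (tl _ (mulr_gt0 b_gt0 e10))
     (tl _ (mulr_gt0 b_gt0 e20)))) => m [/= h0 [/andP[h1 h2] /andP[h3 h4]]].
  split; [apply: H1|apply: H2]; rewrite ?ler_pM2r ?ltr_pdivlMr ?mulrBl ?divfK ?gt_eqF //; lra.
exists (fun j => Num.floor ((j%:~R * a - t) / b) + 1),
       (fun j => Num.floor ((j%:~R * a + c - t) / b) + 1); split.
  move=> j; have [e1 e10 H1] := ceil_right_const ((j%:~R * a - t) / b).
  have [e2 e20 H2] := ceil_right_const ((j%:~R * a + c - t) / b).
  apply: ultraS (ultraI UU side (ultraI UU (tl _ (mulr_gt0 b_gt0 e10))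
     (tl _ (mulr_gt0 b_gt0 e20)))) => m [/= /negP h0 [/andP[h1 h2] /andP[h3 h4]]].
  rewrite -ltNge in h0.
  split; [apply: H1|apply: H2]; rewrite ?ltr_pM2r ?ltr_pdivrMr ?mulrDl ?divfK ?gt_eqF //; lra.
(* By [ceil (- y) = - floor y], the upper end of row [- j] at time [c - t] is
   [- floor ((j a - t) / b)], and its lower end is [- floor ((j a + c - t) / b)]. *)
exists (c - t); right => j; rewrite /win_hi /win_lo rmorphN /=; split.
  rewrite ceilNfloor opprK addrC; congr (1 + Num.floor _).
  by field; rewrite gt_eqF.
rewrite ceilNfloor opprK addrC; congr (1 + Num.floor _).
by field; rewrite gt_eqF.
Qed.

(** A counterexample for each [K] is split into two disjoint 0/1 vectors with row sums 1, which have
    entrywise ultralimits. A row involves finitely many entries and is eventually among the rows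
    [|j| <= K], so the limits have row sums 1 everywhere, and their difference is a nonzero null
    vector. *)
Lemma locally_determined_coord : null_trivial a b c ->
  exists K : nat, forall t (x : int -> R), 0 <= t < a ->
    (forall j : int, (`|j| <= K)%N -> Mmul a b c t x j = 0) -> x 0 = 0.
Proof.
move=> nt; apply: contrapT => nK.
have cP K : int_convex (fun j : int => (`|j| <= K)%N).
  by move=> i j k; lia.
have H K : exists p : R * ((int -> bool) * (int -> bool)), 0 <= p.1 <= a /\
    (forall k, ~~ (p.2.1 k && p.2.2 k)) /\
    forall j : int, (`|j| <= K)%N -> Mmul a b c p.1 (fun k => (p.2.1 k)%:R) j = 1 /\
                     Mmul a b c p.1 (fun k => (p.2.2 k)%:R) j = 1.
  apply: contrapT => nH; apply: nK; exists K => t x t0a x0.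
  apply: contrapT => /eqP xn0; apply: nH; case/andP: t0a => t0 ta.
  have w0 : lo t 0 <= 0 < hi t 0.
    rewrite /win_lo /win_hi ceil_le_int ceil_gt_int ler_pdivrMr // ltr_pdivlMr //.
    by rewrite !mul0r; apply/andP; split; have := ltab; have := ltbc; lra.
  have [w1 [w2 [dis ww]]] := @Mmul_split _ _ _ _ a_gt0 ltab ltbc t x _ 0 0 (@cP K) x0 (leq0n K) w0 xn0.
  by exists (t, (w1, w2)); split => //=; rewrite t0 ltW.
have [p pP] := choice H.
have [U [UU Uoo]] := ultraFilterLemma (@eventually_filter).
have [l [h [lh [t tlh]]]] := ultra_windows UU (fun n => (pP n).1).
have lim (w : nat -> int -> bool) :
    (forall K (j : int), (`|j| <= K)%N -> Mmul a b c (p K).1 (fun k => (w K k)%:R) j = 1) ->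
    exists v : int -> bool, (forall k, U [set m | w m k = v k]) /\
      (forall j, \sum_(i < `|h j - l j|%N) (v (l j + i%:Z))%:R = 1 :> R).
  move=> wM; have [v vP] := choice (fun k => ultra_bool UU (fun m => w m k)).
  exists v; split => // j.
  have vI : U [set m | forall i : 'I_(`|h j - l j|), w m (l j + i%:Z) = v (l j + i%:Z)].
    exact: (ultra_forall_ord UU (fun i => vP _)).
  have jK : U [set m | (`|j| <= m)%N] by apply: Uoo; exists `|j|%N.
  have [m [/= [E1 E2] [/= e3 e4]]] := ultra_ex UU (ultraI UU (lh j) (ultraI UU vI jK)).
  have := wM m j e4; rewrite Mmul_sum // E1 E2 => E; rewrite -[RHS]E.
  by apply: eq_bigr => i _; rewrite e3.
have [v1 [v1U v1M]] := lim (fun K => (p K).2.1) (fun K j jK => ((pP K).2.2 j jK).1).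
have [v2 [v2U v2M]] := lim (fun K => (p K).2.2) (fun K j jK => ((pP K).2.2 j jK).2).
have dis k : ~~ (v1 k && v2 k).
  have [m [/= <- <-]] := ultra_ex UU (ultraI UU (v1U k) (v2U k)).
  exact: (pP m).2.1.
pose z k : R := (v1 k)%:R - (v2 k)%:R.
have zT k : z k = -1 \/ z k = 0 \/ z k = 1.
  rewrite /z; have := dis k; case: (v1 k); case: (v2 k) => //= _.
  - by right; right; lra.
  - by left; lra.
  - by right; left; lra.
have zM j : \sum_(i < `|h j - l j|%N) z (l j + i%:Z) = 0.
  by rewrite /z big_split /= sumrN v1M v2M subrr.
have zn0 : exists k, z k != 0.
  apply: contrapT => nz; have := v1M 0; rewrite big1.
    by move/eqP; rewrite eq_sym oner_eq0.
  move=> i _; have := dis (l 0 + i%:Z); case E1 : (v1 _) => //=.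
  case E2 : (v2 _) => // _; case: nz; exists (l 0 + i%:Z).
  by rewrite /z E1 E2 subr0 oner_eq0.
have [k zk] := zn0; case: tlh => tlh.
  suff /(_ k)/eqP : forall k, z k = 0 by rewrite (negbTE zk).
  apply: (nt t z zT) => j; rewrite Mmul_sum //; have [<- <-] := tlh j; exact: zM.
suff /(_ (- k))/eqP : forall k, z (- k) = 0 by rewrite opprK (negbTE zk).
apply: (nt t (fun k => z (- k))) => [i|j]; first exact: zT.
have [X pX] := primitive_exists z.
(* The primitive of [k |-> z (- k)] is [i |-> - X (1 - i)]; the shift by one matches the ends
   [1 - hi] and [1 - lo] of the limit windows. *)
rewrite (@Mmul_primitive _ _ _ _ a_gt0 ltab ltbc t _ (fun i => - X (1 - i))); last first.
  move=> i; have -> : 1 - i = - i + 1 by lia.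
  have -> : 1 - (i + 1) = - i by lia.
  by rewrite pX opprD addrNK.
have := zM (- j); have [-> ->] := tlh (- j); rewrite !opprK (primitive_sum pX) => E.
rewrite addrC -[RHS]E; congr (X _ - _).
by have := win_lo_le_hi a_gt0 ltab ltbc t j; lia.
Qed.

Lemma window_bound (K : nat) : exists L : nat,
  forall (j k : int) t, (`|j| <= K)%N -> 0 <= t < b ->
    chi c (t - j%:~R * a + k%:~R * b) != 0 -> (`|k| <= L)%N.
Proof.
have c0 : 0 < c by exact: lt_trans ltbc.
have q0 : 0 <= K%:R + 1 + c / b :> R by rewrite !addr_ge0 ?ler0n ?ler01 ?divr_ge0 ?ltW.
(* [k b] is a point of [[0, c[], plus [j a] of size at most [K b], minus a time in [[0, b[]. *)
exists (Num.bound (K%:R + 1 + c / b)) => j k t jK /andP[t0 tb].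
rewrite /chi; case: ifP => [/andP[h1 h2] _|]; last by rewrite eqxx.
have := archi_boundP q0; set L := Num.bound _ => hL.
have jK' : `|j%:~R| <= K%:R :> R.
  by rewrite -intr_norm -abszE -pmulrn ler_nat.
have : `|k%:~R| < L%:R :> R.
  apply: le_lt_trans hL; rewrite -(ler_pM2r b_gt0) !mulrDl divfK ?gt_eqF // mul1r.
  have ja : `|j%:~R * a| <= K%:R * b.
    rewrite normrM; apply: ler_pM => //; rewrite gtr0_norm // ltW //.
  move: ja; rewrite ler_norml => /andP[ja1 ja2].
  rewrite -[X in _ * X <= _](gtr0_norm b_gt0) -normrM ler_norml.
  by apply/andP; split; lra.
by rewrite -intr_norm -abszE -pmulrn ltr_nat => /ltnW.
Qed.

Lemma Mmul_finite (L : nat) t (x : int -> R) j :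
  (forall k, chi c (t - j%:~R * a + k%:~R * b) != 0 -> (`|k| <= L)%N) ->
  Mmul a b c t x j = \sum_(i < L.*2.+1)
    chi c (t - j%:~R * a + (i%:Z - L%:Z)%:~R * b) * x (i%:Z - L%:Z).
Proof.
move=> kL; pose s := [seq i%:Z - L%:Z | i <- index_iota 0 L.*2.+1].
have us : uniq s by rewrite map_inj_uniq ?iota_uniq // => p q; lia.
rewrite /Mmul -(@fsbig_widen _ _ _ _ [set` s]) //; last first.
  move=> k [_ /= ks]; have [->|/kL kl] := eqVneq (chi c (t - j%:~R * a + k%:~R * b)) 0.
    by rewrite mul0r.
  case: ks; apply/mapP; exists `|(k + L%:Z)%R|%N; last by lia.
  by rewrite mem_index_iota; lia.
by rewrite -fsbig_seq // big_map big_mkord.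
Qed.

(** The rows [|j| <= K] see only columns [|k| <= L], so they form a boolean matrix of fixed size
    whatever [t] is; the constant for all such matrices is therefore uniform in [t]. *)
Lemma local_stability : null_trivial a b c -> exists (K L : nat) (C : R), 0 <= C /\
  (forall (j k : int) t, (`|j| <= K)%N -> 0 <= t < b ->
    chi c (t - j%:~R * a + k%:~R * b) != 0 -> (`|k| <= L)%N) /\
  forall t (x : int -> R), 0 <= t < a ->
    x 0 ^+ 2 <= C * \sum_(j < K.*2.+1) (\sum_(k < L.*2.+1)
      chi c (t - (j%:Z - K%:Z)%:~R * a + (k%:Z - L%:Z)%:~R * b) * x (k%:Z - L%:Z)) ^+ 2.
Proof.
move=> /locally_determined_coord[K HK]; have [L HL] := window_bound K.
have L0 : (L < L.*2.+1)%N by lia.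
have [C [C0 HC]] := boolmx_coord_bound R K.*2.+1 (Ordinal L0).
exists K, L, C; split=> //; split=> // t x t0a.
pose B : 'M[bool]_(K.*2.+1, L.*2.+1) := \matrix_(j, k)
  (chi c (t - (j%:Z - K%:Z)%:~R * a + (k%:Z - L%:Z)%:~R * b) != 0).
have BE (j : 'I_K.*2.+1) (k : 'I_L.*2.+1) : (B j k)%:R =
    chi c (t - (j%:Z - K%:Z)%:~R * a + (k%:Z - L%:Z)%:~R * b).
  by rewrite mxE /chi; case: ifP; rewrite ?eqxx ?oner_eq0.
have Brow (y : 'cV[R]_L.*2.+1) j : (map_mx (fun e : bool => e%:R) B *m y) j 0 =
   \sum_(k < L.*2.+1) chi c (t - (j%:Z - K%:Z)%:~R * a + (k%:Z - L%:Z)%:~R * b) * y k 0.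
  by rewrite mxE; apply: eq_bigr => k _; rewrite mxE BE.
have ker (y : 'cV[R]_L.*2.+1) :
    map_mx (fun e : bool => e%:R) B *m y = 0 -> y (Ordinal L0) 0 = 0.
  (* Outside [[- L, L]] the entries of [x'] are whatever [absz] and [inord] return; the rows
     [|j| <= K] do not see them. *)
  move=> By; pose x' (k : int) := y (inord `|(k + L%:Z)%R|%N) 0.
  have x'E (k : 'I_L.*2.+1) : x' (k%:Z - L%:Z) = y k 0.
    by rewrite /x' subrK /= inord_val.
  transitivity (x' 0).
    by rewrite -(x'E (Ordinal L0)) /= subrr.
  apply: (HK t) => // j jK.
  rewrite (@Mmul_finite L); last first.
    move=> k; apply: HL => //; case/andP: t0a => -> /= ta; exact: lt_trans ltab.
  have jl : (`|(j + K%:Z)%R| < K.*2.+1)%N by lia.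
  transitivity ((map_mx (fun e : bool => e%:R) B *m y) (Ordinal jl) 0); last first.
    by rewrite By mxE.
  rewrite Brow; apply: eq_bigr => k _; rewrite x'E /=.
  by have -> : `|(j + K%:Z)%R|%N%:Z - K%:Z = j by lia.
have := HC B ker (\col_k x (k%:Z - L%:Z)).
rewrite mxE /= subrr => /le_trans; apply; rewrite ler_wpM2l //.
rewrite le_eqVlt; apply/orP; left; apply/eqP; apply: eq_bigr => j _; congr (_ ^+ 2).
by rewrite Brow; apply: eq_bigr => k _; rewrite mxE.
Qed.

End LocalStability.

(** * Square-integrable functions *)

Section RealIntegral.
Variable R : realType.
Local Notation mu := (@lebesgue_measure R).
Implicit Types (f g u v : R -> R).

Definition intg f := mu.-integrable setT (EFin \o f).
Definition rint f : R := Rintegral mu setT f.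

Lemma intg_meas f : intg f -> measurable_fun setT f.
Proof. by move=> /integrableP[/measurable_EFinP]. Qed.

Lemma intg_dom f g : measurable_fun setT f -> (forall x, `|f x| <= g x) ->
  intg g -> intg f.
Proof.
move=> mf fg ig; apply: (le_integrable _ _ _ ig) => //.
  exact/measurable_EFinP.
by move=> x _ /=; rewrite lee_fin; apply: le_trans (fg x) (ler_norm _).
Qed.

Lemma intgD f g : intg f -> intg g -> intg (fun x => f x + g x).
Proof. by move=> h1 h2; have := integrableD measurableT h1 h2. Qed.

Lemma intgZ k f : intg f -> intg (fun x => k * f x).
Proof. by move=> h1; have := integrableZl measurableT k h1. Qed.

Lemma intg0 : intg (fun=> 0).
Proof. exact: integrable0. Qed.

Lemma eq_rint f g : f =1 g -> rint f = rint g.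
Proof. by move=> fg; apply: eq_Rintegral => x _. Qed.

Lemma rintD f g : intg f -> intg g -> rint (fun x => f x + g x) = rint f + rint g.
Proof. exact: RintegralD. Qed.

Lemma rintZ k f : intg f -> rint (fun x => k * f x) = k * rint f.
Proof. by move=> h; rewrite /rint RintegralZl. Qed.

Lemma rint0 : rint (fun=> 0) = 0.
Proof. by rewrite /rint /Rintegral integral0. Qed.

Lemma rint_ge0 f : (forall x, 0 <= f x) -> 0 <= rint f.
Proof. by move=> f0; apply: Rintegral_ge0. Qed.

Lemma le_rint f g : intg f -> intg g -> (forall x, f x <= g x) -> rint f <= rint g.
Proof. by move=> h1 h2 fg; apply: le_Rintegral. Qed.

Lemma intg_sum (T : Type) (s : seq T) (F : T -> R -> R) :
  (forall i, intg (F i)) -> intg (fun x => \sum_(i <- s) F i x).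
Proof.
move=> iF; elim: s => [|i s IH].
  by under eq_fun do rewrite big_nil; exact: intg0.
by under eq_fun do rewrite big_cons; exact: intgD.
Qed.

Lemma rint_sum (T : Type) (s : seq T) (F : T -> R -> R) :
  (forall i, intg (F i)) -> rint (fun x => \sum_(i <- s) F i x) = \sum_(i <- s) rint (F i).
Proof.
move=> iF; elim: s => [|i s IH].
  by under eq_rint do rewrite big_nil; rewrite big_nil rint0.
under eq_rint do rewrite big_cons.
by rewrite big_cons rintD ?IH //; exact: intg_sum.
Qed.

Lemma measurable_addr (s : R) : measurable_fun setT (fun x : R => x + s).
Proof. exact: measurable_funD. Qed.

(** By uniqueness of Lebesgue measure it suffices to compare lengths of intervals []p, q]]. *)
Lemma lebesgue_measure_shift (s : R) (A : set R) : measurable A ->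
  pushforward mu ((fun x => x + s) : _ -> measurableTypeR R) A = mu A.
Proof.
move=> mA; apply/esym/lebesgue_measure_unique => //=; first exact: measurable_addr.
move=> _ _ [[p q]] _ <-.
rewrite /pushforward.
have -> : ((fun x => x + s) @^-1` `]p, q]) = `](p - s), (q - s)]%classic.
  by apply/seteqP; split=> x /=; rewrite !in_itv /= => /andP[h1 h2]; apply/andP; split; lra.
rewrite !lebesgue_measure_itv /= !lte_fin ltrD2r; case: ifP => // _.
by rewrite -!EFinD; congr _%:E; lra.
Qed.


Let shift_integral f (s : R) : (\int[mu]_x (f x)%:E =
  \int[pushforward mu ((fun x => (x + s)%R) : _ -> measurableTypeR R)]_x (f x)%:E)%E.
Proof. by apply: eq_measure_integral => [|m A mA _]; [exact: measurable_addr|exact/esym/lebesgue_measure_shift]. Qed.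

Lemma intg_shift f s : intg f -> intg (fun x => f (x + s)).
Proof.
move=> /integrableP[/measurable_EFinP mf lf]; apply/integrableP; split.
  by apply/measurable_EFinP; apply: measurableT_comp => //; exact: measurable_addr.
move: lf; rewrite (@shift_integral (fun x => `|f x|) s) /=.
rewrite ge0_integral_pushforward //=; first exact: measurable_addr.
by apply/measurable_EFinP; exact: measurableT_comp.
Qed.

Lemma rint_shift f s : intg f -> rint (fun x => f (x + s)) = rint f.
Proof.
move=> fi; rewrite /rint /Rintegral [in RHS](shift_integral f s); congr fine.
rewrite integral_pushforward //; first exact: measurable_addr.
  by apply/measurable_EFinP; exact: intg_meas.
exact: intg_shift.
Qed.

Lemma L2_meas u : L2real u -> measurable_fun setT u.
Proof. by case. Qed.

Lemma L2_mul u v : L2real u -> L2real v -> intg (fun x => u x * v x).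
Proof.
move=> [mu_ iu] [mv iv]; apply: (@intg_dom _ (fun x => u x ^+ 2 + v x ^+ 2)).
- exact: measurable_funM.
- move=> x; rewrite ler_norml; apply/andP; split; nra.
- exact: (@intgD (fun x => u x ^+ 2) (fun x => v x ^+ 2)).
Qed.

Lemma L2_dom u v : measurable_fun setT u -> (forall x, `|u x| <= `|v x|) ->
  L2real v -> L2real u.
Proof.
move=> mu_ uv [mv iv]; split => //.
apply: (@intg_dom (fun x => u x ^+ 2) (fun x => v x ^+ 2)) => //.
  exact: measurable_funX.
by move=> x; rewrite normrX -[v x ^+ 2]real_normK ?num_real // lerXn2r ?nnegrE.
Qed.

Lemma L2D u v : L2real u -> L2real v -> L2real (fun x => u x + v x).
Proof.
move=> Lu Lv; have [mu_ iu] := Lu; have [mv iv] := Lv; split.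
  exact: measurable_funD.
rewrite (_ : (fun x => ((u x + v x) ^+ 2)%:E) =
  EFin \o (fun x => (u x ^+ 2 + v x ^+ 2) + 2 * (u x * v x))); last first.
  by apply/funext => x /=; congr _%:E; ring.
apply: intgD; first exact: (@intgD (fun x => u x ^+ 2) (fun x => v x ^+ 2)).
by apply: intgZ; exact: L2_mul.
Qed.

Lemma L2_mulbd M g u : measurable_fun setT g -> (forall x, `|g x| <= M) ->
  L2real u -> L2real (fun x => g x * u x).
Proof.
move=> mg gM Lu; have [mu_ iu] := Lu; split; first exact: measurable_funM.
apply: (@intg_dom (fun x => (g x * u x) ^+ 2) (fun x => M ^+ 2 * u x ^+ 2)).
- by apply: measurable_funX; exact: measurable_funM.
- move=> x; rewrite exprMn normrM !normrX ler_pM ?exprn_ge0 //.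
    by rewrite lerXn2r ?nnegrE //; apply: le_trans (gM x).
  by rewrite -normrX ger0_norm ?sqr_ge0.
- exact: (@intgZ _ (fun x => u x ^+ 2)).
Qed.

Lemma L2Z k u : L2real u -> L2real (fun x => k * u x).
Proof. by apply: (@L2_mulbd `|k|). Qed.

Lemma L2B u v : L2real u -> L2real v -> L2real (fun x => u x - v x).
Proof.
move=> Lu Lv; under eq_fun do rewrite -mulN1r.
by apply: L2D => //; exact: L2Z.
Qed.

Lemma L20 : L2real (fun=> 0 : R).
Proof.
by split => //; under eq_fun do rewrite expr0n /=; exact: intg0.
Qed.

Lemma L2_sum (T : Type) (s : seq T) (F : T -> R -> R) :
  (forall i, L2real (F i)) -> L2real (fun x => \sum_(i <- s) F i x).
Proof.
move=> iF; elim: s => [|i s IH].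
  by under eq_fun do rewrite big_nil; exact: L20.
by under eq_fun do rewrite big_cons; exact: L2D.
Qed.

Lemma L2_shift u s : L2real u -> L2real (fun x => u (x + s)).
Proof.
move=> [mu_ iu]; split.
  by apply: measurableT_comp => //; exact: measurable_addr.
exact: (@intg_shift (fun x => u x ^+ 2)).
Qed.

Lemma intg_indic_itv p q : intg (\1_(`[p, q[%classic) : R -> R).
Proof. exact: integrable_indic_itv. Qed.

Lemma L2_indic_itv p q : L2real (\1_(`[p, q[%classic) : R -> R).
Proof.
split; first exact: measurable_indic.
rewrite (_ : (fun x => _) = EFin \o (\1_(`[p, q[%classic) : R -> R)).
  exact: intg_indic_itv.
by apply/funext => x /=; rewrite indicE; case: (_ \in _); rewrite ?expr1n ?expr0n.
Qed.

Lemma rint_indic_itv p q : p <= q -> rint (\1_(`[p, q[%classic) : R -> R) = q - p.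
Proof.
move=> pq; rewrite /rint /Rintegral integral_indic // setIT.
have := @lebesgue_measure_itv R `[p, q[; rewrite /= lte_fin => ->.
by case: ifP => // pq'; have -> : p = q; rewrite ?subrr //; apply/eqP; rewrite eq_le pq leNgt pq'.
Qed.

Definition ip u v : R := rint (fun x => u x * v x).

Lemma ipC u v : ip u v = ip v u.
Proof. by apply: eq_rint => x; rewrite mulrC. Qed.

Lemma ip_ge0 u : 0 <= ip u u.
Proof. by apply: rint_ge0 => x; rewrite -expr2 sqr_ge0. Qed.

Lemma ipZl k u w : L2real u -> L2real w -> ip (fun x => k * u x) w = k * ip u w.
Proof.
move=> Lu Lw; rewrite -rintZ; try exact: L2_mul.
by apply: eq_rint => x; rewrite mulrA.
Qed.

Lemma ip_suml (T : Type) (s : seq T) (F : T -> R -> R) w :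
  (forall i, L2real (F i)) -> L2real w ->
  ip (fun x => \sum_(i <- s) F i x) w = \sum_(i <- s) ip (F i) w.
Proof.
move=> LF Lw; rewrite -rint_sum; last by move=> i; exact: L2_mul.
by apply: eq_rint => x; rewrite mulr_suml.
Qed.

Lemma sqnormB u v : L2real u -> L2real v ->
  ip (fun x => u x - v x) (fun x => u x - v x) = ip u u + ip v v - 2 * ip u v.
Proof.
move=> Lu Lv; rewrite /ip -rintD; try exact: L2_mul.
rewrite -[- (2 * _)]mulNr -rintZ; last exact: L2_mul.
rewrite -rintD; first by apply: eq_rint => x; ring.
  by apply: intgD; exact: L2_mul.
by apply: intgZ; exact: L2_mul.
Qed.

Lemma sqnormD_le u v : L2real u -> L2real v ->
  ip (fun x => u x + v x) (fun x => u x + v x) <= 2 * ip u u + 2 * ip v v.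
Proof.
move=> Lu Lv; rewrite /ip -!rintZ -?rintD; try (exact: L2_mul || (apply: intgZ; exact: L2_mul)).
apply: le_rint.
- by apply: L2_mul; exact: L2D.
- by apply: intgD; apply: intgZ; exact: L2_mul.
- by move=> x; have := sqr_ge0 (u x - v x); nra.
Qed.

Lemma rint_dct (F : nat -> R -> R) f g : (forall n, measurable_fun setT (F n)) ->
  measurable_fun setT f -> intg g -> (forall n x, `|F n x| <= g x) ->
  {ae mu, forall x, F n x @[n --> \oo] --> f x} ->
  rint (F n) @[n --> \oo] --> rint f.
Proof.
move=> mF mf ig Fg Ff.
have [|||||fi _ cI] := @dominated_convergence _ _ _ mu setT measurableT
   (fun n => EFin \o F n) (EFin \o f) (EFin \o g).
- by move=> n; apply/measurable_EFinP; exact: mF.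
- by apply/measurable_EFinP; exact: mf.
- case: Ff => N [mN N0 NF]; exists N; split => // x nx; apply: NF => cx; apply: nx => _.
  by apply: cvg_EFin => //; exact: nearW.
- exact: ig.
- by apply: aeW => x n _ /=; rewrite lee_fin.
apply: fine_cvg; rewrite fineK //.
exact: integrable_fin_num.
Qed.

Lemma sqnorm_cvg (G : nat -> R -> R) f h : (forall n, measurable_fun setT (G n)) ->
  measurable_fun setT f -> L2real h ->
  (forall n x, `|G n x| <= `|h x|) -> (forall x, `|f x| <= `|h x|) ->
  {ae mu, forall x, G n x @[n --> \oo] --> f x} ->
  ip (fun x => f x - G n x) (fun x => f x - G n x) @[n --> \oo] --> (0 : R).
Proof.
move=> mG mf Lh Gh fh cv; rewrite -[X in _ --> X]rint0.
apply: (@rint_dct _ _ (fun x => 4 * (h x * h x))).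
- by move=> n; apply: measurable_funM; exact: measurable_funB.
- exact: measurable_cst.
- by apply: intgZ; exact: L2_mul.
- move=> n x; rewrite normrM.
  have -> : 4 * (h x * h x) = (2 * `|h x|) * (2 * `|h x|).
    by rewrite mulrACA -normrM [`|h x * h x|]ger0_norm -?expr2 ?sqr_ge0 //; lra.
  have : `|f x - G n x| <= 2 * `|h x|.
    by apply: le_trans (ler_normB _ _) _; have := Gh n x; have := fh x; lra.
  by move=> hh; apply: ler_pM.
- case: cv => N [mN N0 NF]; exists N; split => // x nx; apply: NF => cx; apply: nx.
  have h1 : f x - G n x @[n --> \oo] --> (0 : R).
    by rewrite -(subrr (f x)); apply: cvgB => //; exact: cvg_cst.
  have h2 := cvgM h1 h1; rewrite mulr0 in h2; exact: h2.
Qed.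

End RealIntegral.

(** * The trigonometric system *)

Section Orthogonal.
Variable R : realType.
Variables (T : finType) (g : T -> R -> R) (d : T -> R).
Hypotheses (Lg : forall i, L2real (g i)) (d_ge0 : forall i, 0 <= d i).
Hypothesis orth : forall i j, ip (g i) (g j) = if i == j then d i else 0.

(** The coefficients are arbitrary because three choices are made later: Fourier coefficients for
    Bessel, those of an approximant for Parseval, and [u = 0] for the norm of a combination of
    disjoint cells. *)
Lemma sqnorm_orthB u (x : T -> R) : L2real u ->
  ip (fun t => u t - \sum_i x i * g i t) (fun t => u t - \sum_i x i * g i t) =
  ip u u + \sum_i (d i * x i ^+ 2 - 2 * x i * ip u (g i)).
Proof.
move=> Lu; have LP : L2real (fun t => \sum_i x i * g i t).
  by apply: L2_sum => i; exact: L2Z.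
rewrite sqnormB // -addrA; congr (_ + _).
rewrite ip_suml //; last by move=> i; exact: L2Z.
rewrite [ip u _]ipC ip_suml //; last by move=> i; exact: L2Z.
rewrite mulr_sumr -sumrB; apply: eq_bigr => i _; congr (_ - _).
  rewrite ipZl // ipC ip_suml //; last by move=> j; exact: L2Z.
  rewrite (bigD1 i) //= big1 ?addr0; last first.
    by move=> j ji; rewrite ipZl // orth (negbTE ji) mulr0.
  by rewrite ipZl // orth eqxx; ring.
by rewrite ipZl // ipC; ring.
Qed.

(* The value [x / 0 = 0] makes degenerate vectors ([d i = 0]) harmless. *)
Lemma bessel u : L2real u -> (forall i, d i = 0 -> ip u (g i) = 0) ->
  \sum_i ip u (g i) ^+ 2 / d i <= ip u u.
Proof.
move=> Lu ud; have := ip_ge0 (fun t => u t - \sum_i (ip u (g i) / d i) * g i t).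
rewrite sqnorm_orthB // => h; rewrite -subr_ge0.
suff -> : ip u u - \sum_i ip u (g i) ^+ 2 / d i = ip u u + \sum_i
  (d i * (ip u (g i) / d i) ^+ 2 - 2 * (ip u (g i) / d i) * ip u (g i)) by [].
rewrite -sumrN; congr (_ + _); apply: eq_bigr => i _.
have [d0|dn] := eqVneq (d i) 0; first by rewrite ud // d0; ring.
by field.
Qed.

(** After expansion the difference of the two sides is a sum of terms
    [(d i * x i - ip u (g i)) ^+ 2 / d i]. Any approximant, not only the best one, thus bounds the
    defect in Bessel's inequality. *)
Lemma sqnorm_le_approx u (x : T -> R) : L2real u ->
  (forall i, d i = 0 -> ip u (g i) = 0) ->
  ip u u <= ip (fun t => u t - \sum_i x i * g i t) (fun t => u t - \sum_i x i * g i t)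
    + \sum_i ip u (g i) ^+ 2 / d i.
Proof.
move=> Lu ud; rewrite sqnorm_orthB // -addrA lerDl -big_split /=.
apply: sumr_ge0 => i _; have [d0|dn] := eqVneq (d i) 0.
  by rewrite ud // d0 !(mul0r, mulr0, expr0n) /= !(mul0r, subr0, addr0).
have dp : 0 < d i by rewrite lt_def dn d_ge0.
have -> : d i * x i ^+ 2 - 2 * x i * ip u (g i) + ip u (g i) ^+ 2 / d i =
   (d i * x i - ip u (g i)) ^+ 2 / d i by field.
by rewrite divr_ge0 // sqr_ge0.
Qed.

End Orthogonal.

(** * Integrals of sines and cosines over periods *)

Section Trig.
Variables (R : realType) (b : R).
Hypothesis b_gt0 : 0 < b.

Definition ind (p q t : R) : R := ((p <= t) && (t < q))%:R.
Definition cosw (n : int) (t : R) : R := cos (2 * pi * n%:~R * t / b).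
Definition sinw (n : int) (t : R) : R := sin (2 * pi * n%:~R * t / b).

Lemma indE p q : ind p q = \1_(`[p, q[%classic).
Proof.
apply/funext => t; rewrite /ind indicE; congr ((nat_of_bool _)%:R).
by apply/idP/idP; rewrite inE /= in_itv.
Qed.

Lemma L2_ind p q : L2real (ind p q).
Proof. by rewrite indE; exact: L2_indic_itv. Qed.

Lemma intg_ind p q : intg (ind p q).
Proof. by rewrite indE; exact: intg_indic_itv. Qed.

Lemma rint_ind p q : p <= q -> rint (ind p q) = q - p.
Proof. by rewrite indE; exact: rint_indic_itv. Qed.

Lemma ind_norm p q t : `|ind p q t| <= 1.
Proof. by rewrite /ind; case: (_ && _); rewrite ?normr1 ?normr0. Qed.

Lemma ind_ge0 p q t : 0 <= ind p q t.
Proof. by rewrite /ind ler0n. Qed.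

Lemma ind_sqr p q t : ind p q t * ind p q t = ind p q t.
Proof. by rewrite /ind; case: (_ && _); rewrite ?mulr0 ?mulr1. Qed.

Lemma measurable_ind p q : measurable_fun setT (ind p q).
Proof. by case: (L2_ind p q). Qed.

Lemma ind_split p q r t : p <= q -> q <= r -> ind p r t = ind p q t + ind q r t.
Proof.
move=> pq qr; rewrite /ind; case: (leP p t) => pt; case: (ltP t r) => tr;
  case: (ltP t q) => tq; rewrite ?addr0 ?add0r //=; lra.
Qed.

Lemma ind_shift p q s t : ind (p + s) (q + s) (t + s) = ind p q t.
Proof. by rewrite /ind lerD2r ltrD2r. Qed.

Lemma measurable_cosw n : measurable_fun setT (cosw n).
Proof.
apply: continuous_measurable_fun => t; apply: continuous_comp; last exact: continuous_cos.
by apply: cvgM; [apply: cvgM; [exact: cvg_cst|exact: cvg_id]|exact: cvg_cst].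
Qed.

Lemma measurable_sinw n : measurable_fun setT (sinw n).
Proof.
apply: continuous_measurable_fun => t; apply: continuous_comp; last exact: continuous_sin.
by apply: cvgM; [apply: cvgM; [exact: cvg_cst|exact: cvg_id]|exact: cvg_cst].
Qed.

Lemma cosw_norm n t : `|cosw n t| <= 1. Proof. exact: cos_max. Qed.
Lemma sinw_norm n t : `|sinw n t| <= 1. Proof. exact: sin_max. Qed.

Lemma coswN n t : cosw (- n) t = cosw n t.
Proof. by rewrite /cosw rmorphN /= mulrN !mulNr cosN. Qed.

Lemma sinwN n t : sinw (- n) t = - sinw n t.
Proof. by rewrite /sinw rmorphN /= mulrN !mulNr sinN. Qed.

Lemma cosw0 t : cosw 0 t = 1. Proof. by rewrite /cosw mulr0 !mul0r cos0. Qed.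
Lemma sinw0 t : sinw 0 t = 0. Proof. by rewrite /sinw mulr0 !mul0r sin0. Qed.

Let arg n m t : 2 * pi * (n + m)%:~R * t / b =
  2 * pi * n%:~R * t / b + 2 * pi * m%:~R * t / b :> R.
Proof. by rewrite rmorphD /= mulrDr !mulrDl. Qed.

Let argB n m t : 2 * pi * (n - m)%:~R * t / b =
  2 * pi * n%:~R * t / b - 2 * pi * m%:~R * t / b :> R.
Proof. by rewrite rmorphB /= mulrBr !mulrBl. Qed.

Lemma coswM n m t : cosw n t * cosw m t = 2^-1 * (cosw (n - m) t + cosw (n + m) t).
Proof. by rewrite /cosw argB arg cosB cosD; lra. Qed.

Lemma sinwM n m t : sinw n t * sinw m t = 2^-1 * (cosw (n - m) t - cosw (n + m) t).
Proof. by rewrite /cosw /sinw argB arg cosB cosD; lra. Qed.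

Lemma sinw_cosw n m t : sinw n t * cosw m t = 2^-1 * (sinw (n + m) t + sinw (n - m) t).
Proof. by rewrite /cosw /sinw argB arg sinB sinD; lra. Qed.

Let bn0 : b != 0. Proof. by rewrite gt_eqF. Qed.

Lemma trigw_periodn n (Q : nat) t : cosw n (t + Q%:R * b) = cosw n t /\ sinw n (t + Q%:R * b) = sinw n t.
Proof.
have E : 2 * pi * n%:~R * (t + Q%:R * b) / b = 2 * pi * n%:~R * t / b + (n * Q)%:~R * (pi *+ 2).
  by rewrite rmorphM /= -pmulrn -[pi *+ 2]mulr_natl; field.
rewrite /cosw /sinw E; case: (n * Q%:Z) => k.
  by rewrite -pmulrn (mulr_natl (pi *+ 2)); split; [exact: (periodicn (@cosD2pi R))|exact: (periodicn (@sinD2pi R))].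
rewrite NegzE rmorphN /= mulNr -pmulrn (mulr_natl (pi *+ 2)).
set y := _ - _; have -> : 2 * pi * n%:~R * t / b = y + pi *+ 2 *+ k.+1 by rewrite subrK.
by split; apply/esym; [exact: (periodicn (@cosD2pi R))|exact: (periodicn (@sinD2pi R))].
Qed.

Lemma trigw_period n (k : int) t : cosw n (t + k%:~R * b) = cosw n t /\ sinw n (t + k%:~R * b) = sinw n t.
Proof.
case: k => k; first exact: trigw_periodn.
rewrite NegzE rmorphN /= mulNr -pmulrn.
have := trigw_periodn n k.+1 (t - k.+1%:R * b).
by rewrite subrK => -[-> ->].
Qed.

Lemma trigw_half n t : n != 0 ->
  cosw n (t + b / (2 * `|n%:~R|)) = - cosw n t /\ sinw n (t + b / (2 * `|n%:~R|)) = - sinw n t.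
Proof.
move=> n0; have n0' : n%:~R != 0 :> R by rewrite intr_eq0.
wlog npos : n n0 n0' / 0 < n.
  move=> H; case: (ltgtP n 0) => [nneg|npos|E]; [|exact: H|by rewrite E in n0].
  have := H (- n); rewrite oppr_eq0 oppr_gt0 rmorphN /= oppr_eq0 normrN => /(_ n0 n0' nneg).
  by rewrite !coswN !sinwN => -[-> /oppr_inj ->].
have E : 2 * pi * n%:~R * (t + b / (2 * `|n%:~R|)) / b = 2 * pi * n%:~R * t / b + pi.
  rewrite gtr0_norm ?ltr0z //; field; by rewrite ?bn0 ?n0'.
by rewrite /cosw /sinw E; split; [exact: cosDpi|exact: sinDpi].
Qed.

Lemma intg_indM M p q (h : R -> R) : measurable_fun setT h -> (forall t, `|h t| <= M) ->
  intg (fun t => ind p q t * h t).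
Proof.
move=> mh hM; apply: (@intg_dom _ _ (fun t => M * ind p q t)).
- by apply: measurable_funM => //; exact: measurable_ind.
- by move=> t; rewrite normrM [`|ind p q t|]ger0_norm ?ind_ge0 // mulrC ler_wpM2r ?ind_ge0.
- by apply: intgZ; exact: intg_ind.
Qed.

(* Shifting by the antiperiod [s] preserves the integral over a period and changes its sign. *)
Lemma rint_antiperiodic (h : R -> R) p l s : 0 <= s -> s <= l -> measurable_fun setT h ->
  (forall t, `|h t| <= 1) -> (forall t, h (t + l) = h t) -> (forall t, h (t + s) = - h t) ->
  rint (fun t => ind p (p + l) t * h t) = 0.
Proof.
move=> s0 sl mh h1 hl hs.
have J q r : intg (fun t => ind q r t * h t) by exact: (@intg_indM 1).
have add q r z : q <= r -> r <= z -> rint (fun t => ind q z t * h t) =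
    rint (fun t => ind q r t * h t) + rint (fun t => ind r z t * h t).
  by move=> qr rz; rewrite -rintD //; apply: eq_rint => t; rewrite (ind_split _ qr rz) mulrDl.
have E1 := add p (p + s) (p + l); have E2 := add (p + s) (p + l) (p + s + l).
have E3 : rint (fun t => ind (p + l) (p + s + l) t * h t) = rint (fun t => ind p (p + s) t * h t).
  by rewrite -(rint_shift l (J _ _)); apply: eq_rint => t; rewrite ind_shift hl.
have E4 : rint (fun t => ind (p + s) (p + s + l) t * h t) = - rint (fun t => ind p (p + l) t * h t).
  rewrite -(rint_shift s (J _ _)) -mulN1r -rintZ //; apply: eq_rint => t.
  by rewrite -addrA [s + l]addrC addrA ind_shift hs; ring.
by rewrite E4 E3 in E2; lra.
Qed.

(** The antiperiod [b / (2 |n|)] replaces a computation with antiderivatives. *)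
Lemma rint_cosw_sinw p (Q : nat) n : (0 < Q)%N -> n != 0 ->
  rint (fun t => ind p (p + Q%:R * b) t * cosw n t) = 0 /\
  rint (fun t => ind p (p + Q%:R * b) t * sinw n t) = 0.
Proof.
move=> Q0 n0; have nn : 1 <= `|n%:~R| :> R.
  by rewrite -intr_norm -[1]/(1%:~R) ler_int; lia.
have s0 : 0 <= b / (2 * `|n%:~R|) by apply: divr_ge0; [exact: ltW|exact: mulr_ge0].
have sl : b / (2 * `|n%:~R|) <= Q%:R * b.
  rewrite ler_pdivrMr; last by lra.
  have : 1 <= Q%:R :> R by rewrite ler1n.
  move=> Q1; rewrite [_ * b]mulrC -mulrA ler_peMr ?(ltW b_gt0) //.
  have n2 : 1 <= 2 * `|n%:~R| :> R by lra.
  by have := ler_pM ler01 ler01 Q1 n2; rewrite mulr1.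
split; [apply: (@rint_antiperiodic (cosw n) p _ _ s0 sl)|apply: (@rint_antiperiodic (sinw n) p _ _ s0 sl)].
- exact: measurable_cosw.
- exact: cosw_norm.
- by move=> t; have [] := trigw_periodn n Q t.
- by move=> t; have [] := trigw_half t n0.
- exact: measurable_sinw.
- exact: sinw_norm.
- by move=> t; have [] := trigw_periodn n Q t.
- by move=> t; have [] := trigw_half t n0.
Qed.

End Trig.

(** * The orthogonal system on [Q] periods *)

Section TrigSystem.
Variables (R : realType) (b : R).
Hypothesis b_gt0 : 0 < b.

Definition trigw (e : bool) (n : int) (t : R) : R :=
  if e then cosw b n t else sinw b n t.

Lemma measurable_trigw e n : measurable_fun setT (trigw e n).
Proof. by case: e; [exact: measurable_cosw|exact: measurable_sinw]. Qed.

Lemma trigw_norm e n t : `|trigw e n t| <= 1.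
Proof. by case: e; [exact: cosw_norm|exact: sinw_norm]. Qed.

Lemma L2_ind_trigw p q e n : L2real (fun t => ind p q t * trigw e n t).
Proof.
under eq_fun do rewrite mulrC.
by apply: (@L2_mulbd _ 1); [exact: measurable_trigw|exact: trigw_norm|exact: L2_ind].
Qed.

Section Period.
Variables (p : R) (Q N : nat).
Hypothesis Q_gt0 : (0 < Q)%N.

(** The interval has length [Q b] while the frequencies stay multiples of [1 / b]. A large [Q] makes
    room for a window of length [c > b] in Bessel's inequality; completeness is used with
    [Q = 1]. *)
Definition wsys (i : bool * 'I_N) (t : R) : R :=
  ind p (p + Q%:R * b) t * trigw i.1 i.2%:Z t.
(** The index set contains the sine of frequency 0, the zero function, hence the value [0]. *)
Definition wsys_sqnorm (i : bool * 'I_N) : R :=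
  if i.2 == 0%N :> nat then (if i.1 then Q%:R * b else 0) else Q%:R * b / 2.

Let l_gt0 : 0 < Q%:R * b. Proof. by rewrite mulr_gt0 // ltr0n. Qed.

Let J e k := rint (fun t => ind p (p + Q%:R * b) t * trigw e k t).

Let intgJ e k : intg (fun t => ind p (p + Q%:R * b) t * trigw e k t).
Proof. by apply: (@intg_indM _ 1); [exact: measurable_trigw|exact: trigw_norm]. Qed.

Let JE e k : J e k = if e && (k == 0) then Q%:R * b else 0.
Proof.
have [k0|kn] := eqVneq k 0.
  rewrite /J k0; case: e => /=.
    transitivity (rint (ind p (p + Q%:R * b))).
      by apply: eq_rint => t; rewrite cosw0 mulr1.
    by rewrite rint_ind ?lerDl ?(ltW l_gt0) // addrAC subrr add0r.
  by rewrite -[RHS]rint0; apply: eq_rint => t; rewrite sinw0 mulr0.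
rewrite andbF /J; have [h1 h2] := rint_cosw_sinw b_gt0 p Q_gt0 kn.
by case: e.
Qed.

Let comb e k1 k2 (x : R) (h : R -> R) :
  (forall t, h t = 2^-1 * (trigw e k1 t + x * trigw e k2 t)) ->
  rint (fun t => ind p (p + Q%:R * b) t * h t) = 2^-1 * (J e k1 + x * J e k2).
Proof.
move=> hE; rewrite -[x * _]rintZ ?intgJ // -rintD ?intgJ //; last by apply: intgZ; exact: intgJ.
rewrite -rintZ; last by apply: intgD => //; apply: intgZ; exact: intgJ.
by apply: eq_rint => t; rewrite hE; ring.
Qed.

(** Products become sums over the frequencies [n - m] and [n + m], and only a cosine of frequency 0
    has a nonzero integral. As both indices are natural numbers, [n + m = 0] forces [n = m = 0]. *)
Lemma wsys_orth i j : ip (wsys i) (wsys j) = if i == j then wsys_sqnorm i else 0.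
Proof.
case: i j => [e n] [e' m].
have -> : ip (wsys (e, n)) (wsys (e', m)) =
    rint (fun t => ind p (p + Q%:R * b) t * (trigw e n%:Z t * trigw e' m%:Z t)).
  by apply: eq_rint => t; rewrite /wsys /= mulrACA ind_sqr.
rewrite xpair_eqE /wsys_sqnorm /= -val_eqE /=.
case: e; case: e' => /=.
- rewrite (@comb true (n%:Z - m%:Z) (n%:Z + m%:Z) 1); last first.
    by move=> t /=; rewrite coswM mul1r.
  rewrite !JE /= subr_eq0 mul1r.
  have -> : (n%:Z == m%:Z) = (n == m :> nat) by [].
  have -> : (n%:Z + m%:Z == 0) = ((n == 0%N :> nat) && (m == 0%N :> nat)) by apply/eqP/idP; lia.
  case: (eqVneq (n : nat) m) => [->|]; first by rewrite andbb; case: ifP => _; field.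
  move=> nm; have -> : ((n == 0%N :> nat) && (m == 0%N :> nat)) = false by lia.
  by rewrite addr0 mulr0.
- rewrite (@comb false (m%:Z + n%:Z) (m%:Z - n%:Z) 1); last first.
    by move=> t /=; rewrite mulrC sinw_cosw mul1r.
  by rewrite !JE /= mulr0 addr0 mulr0.
- rewrite (@comb false (n%:Z + m%:Z) (n%:Z - m%:Z) 1); last first.
    by move=> t /=; rewrite sinw_cosw mul1r.
  by rewrite !JE /= mulr0 addr0 mulr0.
- rewrite (@comb true (n%:Z - m%:Z) (n%:Z + m%:Z) (-1)); last first.
    by move=> t /=; rewrite sinwM mulN1r.
  rewrite !JE /= subr_eq0 mulN1r.
  have -> : (n%:Z == m%:Z) = (n == m :> nat) by [].
  have -> : (n%:Z + m%:Z == 0) = ((n == 0%N :> nat) && (m == 0%N :> nat)) by apply/eqP/idP; lia.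
  case: (eqVneq (n : nat) m) => [->|]; first by rewrite andbb; case: ifP => _; field.
  move=> nm; have -> : ((n == 0%N :> nat) && (m == 0%N :> nat)) = false by lia.
  by rewrite subr0 mulr0.
Qed.

Lemma wsys_sqnorm_ge0 i : 0 <= wsys_sqnorm i.
Proof.
by rewrite /wsys_sqnorm; case: ifP => _; [case: ifP => _ //; exact: ltW|rewrite divr_ge0 ?ltW].
Qed.

Lemma wsys_degenerate u i : wsys_sqnorm i = 0 -> ip u (wsys i) = 0.
Proof.
case: i => e n; rewrite /wsys_sqnorm /=; case: eqP => [n0|_]; last first.
  by move/eqP; rewrite mulf_eq0 gt_eqF //= invr_eq0 pnatr_eq0.
case: e => [/eqP|_]; first by rewrite gt_eqF.
rewrite -[RHS]rint0; apply: eq_rint => t.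
by rewrite /wsys /= n0 sinw0 !mulr0.
Qed.

Definition wcoef2 (u : R -> R) (n : nat) : R :=
  ip u (fun t => ind p (p + Q%:R * b) t * trigw true n%:Z t) ^+ 2 +
  ip u (fun t => ind p (p + Q%:R * b) t * trigw false n%:Z t) ^+ 2.

Let sum_wsys (F : bool * 'I_N -> R) :
  \sum_i F i = \sum_(n < N) (F (true, n) + F (false, n)).
Proof.
transitivity (\sum_(e : bool) \sum_(n < N) F (e, n)).
  by rewrite pair_big; apply: eq_bigr => -[].
rewrite exchange_big /=; by apply: eq_bigr => n _; rewrite big_bool.
Qed.

Let L2_wsys i : L2real (wsys i). Proof. exact: L2_ind_trigw. Qed.

(** The ratio of [Q b] to a nonzero squared norm is 1 or 2, hence at least 1. The coefficients of
    [u] are those of its restriction to the interval. *)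
Lemma bessel_trig u : L2real u -> \sum_(n < N) wcoef2 u n <=
  Q%:R * b * ip (fun t => ind p (p + Q%:R * b) t * u t) (fun t => ind p (p + Q%:R * b) t * u t).
Proof.
move=> Lu; set v := fun t => _ * u t.
have Lv : L2real v.
  by apply: (@L2_mulbd _ 1) => //; [exact: measurable_ind|exact: ind_norm].
have vu i : ip v (wsys i) = ip u (wsys i).
  apply: eq_rint => t; rewrite /v /wsys [_ * u t]mulrC -mulrA; congr (_ * _).
  by rewrite mulrA ind_sqr.
have := bessel L2_wsys wsys_orth Lv (@wsys_degenerate v).
rewrite -(ler_pM2l l_gt0) => /(le_trans _); apply.
rewrite sum_wsys mulr_sumr; apply: ler_sum => n _.
rewrite mulrDr; apply: lerD; rewrite vu.
- rewrite /wsys_sqnorm /=; case: ifP => _.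
    by rewrite [X in _ <= X]mulrC divfK ?gt_eqF.
  have -> : Q%:R * b * (ip u (wsys (true, n)) ^+ 2 / (Q%:R * b / 2)) =
     2 * ip u (wsys (true, n)) ^+ 2.
    by field; rewrite ?(gt_eqF b_gt0) ?pnatr_eq0 -?lt0n ?Q_gt0.
  by have := sqr_ge0 (ip u (wsys (true, n))); rewrite /wsys /=; lra.
- rewrite -/(wsys (false, n)) /wsys_sqnorm /=; case: ifP => [n0|_].
    rewrite [X in X ^+ 2 <= _](@wsys_degenerate u (false, n)) ?expr0n; last first.
      by rewrite /wsys_sqnorm /= n0.
    by rewrite invr0 !mulr0.
  have -> : Q%:R * b * (ip u (wsys (false, n)) ^+ 2 / (Q%:R * b / 2)) =
     2 * ip u (wsys (false, n)) ^+ 2.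
    by field; rewrite ?(gt_eqF b_gt0) ?pnatr_eq0 -?lt0n ?Q_gt0.
  by have := sqr_ge0 (ip u (wsys (false, n))); rewrite /wsys /=; lra.
Qed.

(** The inverse of a nonzero squared norm is at most [2 / (Q b)], its value at nonzero
    frequencies. *)
Lemma sqnorm_le_trig u (x : bool -> nat -> R) P : L2real u ->
  (forall t, P t = \sum_(n < N) (x true n * trigw true n%:Z t + x false n * trigw false n%:Z t)) ->
  ip u u <= ip (fun t => u t - ind p (p + Q%:R * b) t * P t)
               (fun t => u t - ind p (p + Q%:R * b) t * P t)
            + 2 / (Q%:R * b) * \sum_(n < N) wcoef2 u n.
Proof.
move=> Lu defP.
have := sqnorm_le_approx L2_wsys wsys_sqnorm_ge0 wsys_orth (fun i => x i.1 i.2) Lu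
   (@wsys_degenerate u).
have PE t : \sum_(i : bool * 'I_N) x i.1 i.2 * wsys i t = ind p (p + Q%:R * b) t * P t.
  by rewrite sum_wsys defP mulr_sumr; apply: eq_bigr => n _; rewrite /wsys /=; ring.
have -> : (fun t => u t - \sum_(i : bool * 'I_N) x i.1 i.2 * wsys i t) =
  (fun t => u t - ind p (p + Q%:R * b) t * P t) by apply/funext => t; rewrite PE.
move=> /le_trans; apply; rewrite lerD2l sum_wsys mulr_sumr; apply: ler_sum => n _.
rewrite mulrDr; apply: lerD; rewrite /wsys_sqnorm /=; case: ifP => _.
- rewrite mulrC; have := sqr_ge0 (ip u (wsys (true, n))); rewrite /wsys /= => h.
  by rewrite ler_wpM2r // -[X in X <= _]mul1r ler_wpM2r ?invr_ge0 ?(ltW l_gt0) //; lra.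
- rewrite invf_div mulrC; exact: lexx.
- by rewrite invr0 mulr0 mulr_ge0 ?sqr_ge0 // divr_ge0 ?(ltW l_gt0).
- rewrite invf_div mulrC; exact: lexx.
Qed.

End Period.
End TrigSystem.

(** * Density of trigonometric polynomials *)

Section StepApprox.
Variable R : realType.

Lemma bernoulli_ineq (x : R) m : -1 <= x -> 1 + m%:R * x <= (1 + x) ^+ m.
Proof.
move=> x1; elim: m => [|m IH]; first by rewrite expr0 mul0r addr0.
rewrite exprS -natr1.
have h : (1 + x) * (1 + m%:R * x) <= (1 + x) * (1 + x) ^+ m.
  by apply: ler_wpM2l => //; lra.
apply: le_trans h; have := sqr_ge0 x; have : 0 <= m%:R :> R by [].
by move=> m0 x2; have := mulr_ge0 m0 x2; lra.
Qed.

Lemma step_ge0_le1 (y : R) n : 0 <= y <= 1 -> 0 <= (1 - y ^+ n) ^+ (2 ^ n) <= 1.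
Proof.
move=> /andP[y0 y1]; have := exprn_ile1 n y0 y1; have := exprn_ge0 n y0.
move: (y ^+ n) => x x0 x1; rewrite exprn_ge0 ?exprn_ile1 //; lra.
Qed.

(** Bernoulli's inequality gives the lower bound [1 - (2 y) ^ n]. *)
Lemma step_cvg1 (y : R) : 0 <= y -> y < 2^-1 ->
  (1 - y ^+ n) ^+ (2 ^ n) @[n --> \oo] --> (1 : R).
Proof.
move=> y0 y2; have y01 : 0 <= y <= 1 by rewrite y0 /=; lra.
have h : 1 - (2 * y) ^+ n @[n --> \oo] --> (1 : R).
  rewrite -[X in _ --> X]subr0; apply: cvgB; first exact: cvg_cst.
  by apply: cvg_expr; rewrite ger0_norm; lra.
apply: (@squeeze_cvgr _ _ _ R (fun n => 1 - (2 * y) ^+ n) (fun=> 1)); last 2 first.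
- exact: h.
- exact: cvg_cst.
apply: nearW => n.
have /andP[_ ->] := step_ge0_le1 n y01; rewrite andbT.
have := @bernoulli_ineq (- y ^+ n) (2 ^ n).
rewrite exprMn natrX mulrN; apply; rewrite lerN2 exprn_ile1 //; lra.
Qed.

(** With [x = y ^ n] and [m = 2 ^ n], [(1 - x) ^ m * (1 + x) ^ m <= 1] and Bernoulli's inequality
    for [1 + x] give the upper bound [(2 y) ^ (- n)]. *)
Lemma step_cvg0 (y : R) : 2^-1 < y -> y <= 1 ->
  (1 - y ^+ n) ^+ (2 ^ n) @[n --> \oo] --> (0 : R).
Proof.
move=> y2 y1; have y01 : 0 <= y <= 1 by rewrite y1 andbT; lra.
have h : ((2 * y)^-1) ^+ n @[n --> \oo] --> (0 : R).
  apply: cvg_expr; rewrite ger0_norm ?invr_ge0; last by lra.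
  by rewrite invf_lt1; lra.
apply: (@squeeze_cvgr _ _ _ R (fun=> 0) (fun n => (2 * y)^-1 ^+ n)); last 2 first.
- exact: cvg_cst.
- exact: h.
apply: nearW => n.
have /andP[h0 h1] := step_ge0_le1 n y01; rewrite h0 /=.
have yn : 0 < (2 * y) ^+ n by apply: exprn_gt0; lra.
have x0 : 0 <= y ^+ n by apply: exprn_ge0; lra.
have x1 : y ^+ n <= 1 by apply: exprn_ile1; lra.
have B : (2 * y) ^+ n <= (1 + y ^+ n) ^+ (2 ^ n).
  have := @bernoulli_ineq (y ^+ n) (2 ^ n); rewrite exprMn natrX => B.
  by apply: le_trans (B _) => //; lra.
rewrite exprVn -[X in _ <= X]mul1r ler_pdivlMr //.
apply: (@le_trans _ _ ((1 - y ^+ n) ^+ (2 ^ n) * (1 + y ^+ n) ^+ (2 ^ n))).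
  exact: ler_wpM2l.
by rewrite -exprMn exprn_ile1 //; nra.
Qed.

End StepApprox.

Section TrigPolynomials.
Variables (R : realType) (b : R).
Hypothesis b_gt0 : 0 < b.
Local Notation trigw := (trigw b).

Definition trigpoly (P : R -> R) := exists (N : nat) (x : bool -> nat -> R),
  forall t, P t = \sum_(n < N) (x true n * trigw true n%:Z t + x false n * trigw false n%:Z t).

Lemma trigpoly_widen P N (x : bool -> nat -> R) N' : (N <= N')%N ->
  (forall t, P t = \sum_(n < N) (x true n * trigw true n%:Z t + x false n * trigw false n%:Z t)) ->
  exists x' : bool -> nat -> R, forall t, P t =
    \sum_(n < N') (x' true n * trigw true n%:Z t + x' false n * trigw false n%:Z t).
Proof.
move=> NN PE; exists (fun e n => if (n < N)%N then x e n else 0) => t.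
rewrite PE (big_ord_widen _ (fun n => x true n * trigw true n%:Z t + x false n * trigw false n%:Z t) NN).
rewrite big_mkcond; apply: eq_bigr => n _; case: ifP => // _.
by rewrite !mul0r addr0.
Qed.

Lemma trigpolyD P P' : trigpoly P -> trigpoly P' -> trigpoly (fun t => P t + P' t).
Proof.
move=> [N [x PE]] [N' [x' PE']].
have [y yE] := trigpoly_widen (leq_maxl N N') PE.
have [y' yE'] := trigpoly_widen (leq_maxr N N') PE'.
exists (maxn N N'), (fun e n => y e n + y' e n) => t.
by rewrite yE yE' -big_split /=; apply: eq_bigr => n _; ring.
Qed.

Lemma trigpolyZ k P : trigpoly P -> trigpoly (fun t => k * P t).
Proof.
move=> [N [x PE]]; exists N, (fun e n => k * x e n) => t.
by rewrite PE mulr_sumr; apply: eq_bigr => n _; ring.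
Qed.

Lemma eq_trigpoly P P' : P =1 P' -> trigpoly P -> trigpoly P'.
Proof. by move=> /funext ->. Qed.

Lemma trigpoly_trigw e (n : int) : trigpoly (trigw e n).
Proof.
have nat_case e' (m : nat) : trigpoly (trigw e' m%:Z).
  exists m.+1, (fun e0 n0 => ((e0 == e') && (n0 == m))%:R) => t.
  rewrite big_ord_recr /= big1 ?add0r => [|i _]; last first.
    by rewrite (ltn_eqF (ltn_ord i)) !andbF !mul0r addr0.
  by rewrite eqxx; case: e'; rewrite /= mul1r mul0r ?addr0 ?add0r.
case: n => m; first exact: nat_case.
rewrite NegzE; case: e.
  by apply: eq_trigpoly (nat_case true m.+1) => t; rewrite /= coswN.
by apply: eq_trigpoly (trigpolyZ (-1) (nat_case false m.+1)) => t; rewrite /= sinwN mulN1r.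
Qed.

Lemma trigpoly_cst k : trigpoly (fun=> k).
Proof.
apply: eq_trigpoly (trigpolyZ k (trigpoly_trigw true 0)) => t.
by rewrite /= cosw0 mulr1.
Qed.

Lemma trigpoly_sum (T : Type) (s : seq T) (F : T -> R -> R) :
  (forall i, trigpoly (F i)) -> trigpoly (fun t => \sum_(i <- s) F i t).
Proof.
move=> tF; elim: s => [|i s IH].
  by apply: eq_trigpoly (trigpoly_cst 0) => t; rewrite big_nil.
by apply: eq_trigpoly (trigpolyD (tF i) IH) => t; rewrite big_cons.
Qed.

Lemma trigpoly_trigwM e e' (n m : int) : trigpoly (fun t => trigw e n t * trigw e' m t).
Proof.
have H e0 k1 k2 (x : R) : trigpoly (fun t => 2^-1 * (trigw e0 k1 t + x * trigw e0 k2 t)).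
  by apply/trigpolyZ/trigpolyD; [|apply/trigpolyZ]; exact: trigpoly_trigw.
case: e; case: e'.
- by apply: eq_trigpoly (H true (n - m) (n + m) 1) => t; rewrite /= coswM mul1r.
- by apply: eq_trigpoly (H false (m + n) (m - n) 1) => t; rewrite /= [RHS]mulrC sinw_cosw mul1r.
- by apply: eq_trigpoly (H false (n + m) (n - m) 1) => t; rewrite /= sinw_cosw mul1r.
- by apply: eq_trigpoly (H true (n - m) (n + m) (-1)) => t; rewrite /= sinwM mulN1r.
Qed.

Lemma trigpolyM P P' : trigpoly P -> trigpoly P' -> trigpoly (fun t => P t * P' t).
Proof.
have half e m P0 : trigpoly P0 -> trigpoly (fun t => P0 t * trigw e m t).
  move=> [N [x PE]].
  apply: (@eq_trigpoly (fun t => \sum_(n < N) (x true n * (trigw true n%:Z t * trigw e m t) +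
     x false n * (trigw false n%:Z t * trigw e m t)))).
    by move=> t; rewrite PE mulr_suml; apply: eq_bigr => n _; ring.
  apply: trigpoly_sum => n; apply: trigpolyD; apply: trigpolyZ; exact: trigpoly_trigwM.
move=> tP [N [x PE]].
apply: (@eq_trigpoly (fun t => \sum_(n < N) (x true n * (P t * trigw true n%:Z t) +
     x false n * (P t * trigw false n%:Z t)))).
  by move=> t; rewrite PE mulr_sumr; apply: eq_bigr => n _; ring.
by apply: trigpoly_sum => n; apply: trigpolyD; apply: trigpolyZ; exact: half.
Qed.

Lemma trigpolyX P n : trigpoly P -> trigpoly (fun t => P t ^+ n).
Proof.
move=> tP; elim: n => [|n IH]; first exact: trigpoly_cst.
by apply: eq_trigpoly (trigpolyM tP IH) => t; rewrite exprS.
Qed.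

End TrigPolynomials.

(** * Completeness of the trigonometric system on one period *)

Section Density.
Variables (R : realType) (b p : R).
Hypothesis b_gt0 : 0 < b.
Local Notation mu := (@lebesgue_measure R).
Local Notation ind0 := (ind p (p + b)).
Implicit Types G : R -> R.

Definition sqn G : R := ip G G.

(** Only [P] is cut to the period, so an approximable [G] vanishes almost everywhere outside of
    it. *)
Definition approximable G := L2real G /\ forall e, 0 < e ->
  exists P, trigpoly b P /\ sqn (fun t => G t - ind0 t * P t) < e.

Lemma L2_ind0M u : L2real u -> L2real (fun t => ind0 t * u t).
Proof.
by move=> Lu; apply: (@L2_mulbd _ 1) => //; [exact: measurable_ind|exact: ind_norm].
Qed.

Lemma L2_ind0_trigpoly P : trigpoly b P -> L2real (fun t => ind0 t * P t).
Proof.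
move=> [N [x PE]].
rewrite (_ : (fun t => _) = fun t => \sum_(n < N) (x true n * (ind0 t * trigw b true n%:Z t) +
  x false n * (ind0 t * trigw b false n%:Z t))); last first.
  by apply/funext => t; rewrite PE mulr_sumr; apply: eq_bigr => n _; ring.
by apply: L2_sum => n; apply: L2D; apply: L2Z; exact: L2_ind_trigw.
Qed.

Lemma approximable_lim G : L2real G ->
  (forall e, 0 < e -> exists G', approximable G' /\ sqn (fun t => G t - G' t) < e) ->
  approximable G.
Proof.
move=> LG H; split => // e e0.
have e4 : 0 < e / 4 by lra.
have [G' [[LG' aG'] GG']] := H _ e4; have [P [tP G'P]] := aG' _ e4.
exists P; split => //.
have LP := L2_ind0_trigpoly tP.
have := sqnormD_le (L2B LG LG') (L2B LG' LP).
rewrite [X in X <= _](_ : _ = sqn (fun t => G t - ind0 t * P t)); last first.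
  by apply: eq_rint => t; rewrite !addrA !subrK.
by move: GG' G'P; rewrite /sqn; lra.
Qed.

Lemma approximableD G G' : approximable G -> approximable G' ->
  approximable (fun t => G t + G' t).
Proof.
move=> [LG aG] [LG' aG']; split=> [|e e0]; first exact: L2D.
have e4 : 0 < e / 4 by lra.
have [P [tP GP]] := aG _ e4; have [P' [tP' GP']] := aG' _ e4.
exists (fun t => P t + P' t); split; first exact: trigpolyD.
have := sqnormD_le (L2B LG (L2_ind0_trigpoly tP)) (L2B LG' (L2_ind0_trigpoly tP')).
rewrite [X in X <= _](_ : _ = sqn (fun t => G t + G' t - ind0 t * (P t + P' t))); last first.
  by apply: eq_rint => t; ring.
by move: GP GP'; rewrite /sqn; lra.
Qed.

Lemma approximableZ k G : approximable G -> approximable (fun t => k * G t).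
Proof.
move=> [LG aG]; split=> [|e e0]; first exact: L2Z.
have k0 : 0 < k ^+ 2 + 1 by have := sqr_ge0 k; lra.
have [P [tP GP]] := aG _ (divr_gt0 e0 k0).
exists (fun t => k * P t); split; first exact: trigpolyZ.
have LB := L2B LG (L2_ind0_trigpoly tP).
rewrite (_ : sqn _ = k ^+ 2 * sqn (fun t => G t - ind0 t * P t)); last first.
  rewrite /sqn /ip -rintZ; last exact: L2_mul.
  by apply: eq_rint => t; ring.
move: GP; rewrite ltr_pdivlMr //; have := ip_ge0 (fun t => G t - ind0 t * P t).
by rewrite -/(sqn _); nra.
Qed.

Lemma approximable_sum (T : Type) (s : seq T) (F : T -> R -> R) :
  (forall i, approximable (F i)) -> approximable (fun t => \sum_(i <- s) F i t).
Proof.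
move=> aF; elim: s => [|i s IH].
  under eq_fun do rewrite big_nil.
  split=> [|e e0]; first exact: L20.
  exists (fun=> 0); split; first exact: trigpoly_cst.
  by rewrite /sqn /ip; under eq_rint do rewrite mulr0 subrr mulr0; rewrite rint0.
by under eq_fun do rewrite big_cons; exact: approximableD.
Qed.

(** The vehicle of every passage to the limit below: from polynomials to intervals, along increasing
    unions of sets, and from simple to nonnegative functions. *)
Lemma approximable_cvg (F : nat -> R -> R) G h : (forall n, approximable (F n)) ->
  measurable_fun setT G -> L2real h ->
  (forall n x, `|F n x| <= `|h x|) -> (forall x, `|G x| <= `|h x|) ->
  {ae mu, forall x, F n x @[n --> \oo] --> G x} -> approximable G.
Proof.
move=> aF mG Lh Fh Gh cv; apply: approximable_lim => [|e e0]; first exact: L2_dom Lh.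
have mF n : measurable_fun setT (F n) by case: (aF n) => -[].
have /cvgrPdist_lt/(_ e e0)[n _ /(_ n (leqnn n)) /= hn] := sqnorm_cvg mF mG Lh Fh Gh cv.
exists (F n); split => //.
by move: hn; rewrite sub0r normrN ger0_norm //; exact: ip_ge0.
Qed.

Lemma approximable_trigpoly P : trigpoly b P -> approximable (fun t => ind0 t * P t).
Proof.
move=> tP; split=> [|e e0]; first exact: L2_ind0_trigpoly.
exists P; split => //; rewrite /sqn /ip.
by under eq_rint do rewrite subrr mulr0; rewrite rint0.
Qed.

Let pi_div_lt s : 0 < s -> s < b -> 0 < sin (pi * s / b).
Proof.
move=> s0 sb; apply: sin_gt0_pi; have := pi_gt0 R => pi0.
rewrite divr_gt0 ?mulr_gt0 //= ltr_pdivrMr // ltr_pM2l //.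
Qed.

(* The trigonometric polynomial [y] is below [1/2] exactly on [`]p, q[], and
   [(1 - y ^ n) ^ (2 ^ n)] tends to [1] where [y < 1/2] and to [0] where [y > 1/2]. *)
Lemma approximable_itv q : p < q -> q <= p + b -> approximable (ind p q).
Proof.
move=> pq qb.
(* Each sine changes sign under [t + b], but their product is half of [cos (2 pi t / b - k) - cos
   (pi (q - p) / b)] with [k] as below, a trigonometric polynomial of degree 1. *)
pose y t := 2^-1 - 2^-1 * (sin (pi * (t - p) / b) * sin (pi * (q - t) / b)).
have ty : trigpoly b y.
  pose k := pi * (p + q) / b.
  apply: (@eq_trigpoly _ b (fun t => (2^-1 + 4^-1 * cos (pi * (q - p) / b)) +
    ((- (4^-1 * cos k)) * trigw b true 1 t + (- (4^-1 * sin k)) * trigw b false 1 t))).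
    move=> t; rewrite /y /= /cosw /sinw mulr1.
    have -> : pi * (q - p) / b = pi * (t - p) / b + pi * (q - t) / b.
      by rewrite -mulrDl -mulrDr; congr (_ * _ / _); ring.
    have E : cos (2 * pi * t / b - k) = cos (pi * (t - p) / b - pi * (q - t) / b).
      congr cos; rewrite /k -!mulrBl; congr (_ / _); ring.
    move: E; rewrite [LHS]cosB [RHS]cosB cosD => E.
    lra.
  apply: trigpolyD; first exact: trigpoly_cst.
  by apply: trigpolyD; apply: trigpolyZ; exact: trigpoly_trigw.
have y01 t : 0 <= y t <= 1.
  have := sin_max (pi * (t - p) / b); have := sin_max (pi * (q - t) / b).
  rewrite /y !ler_norml; move: (sin _) (sin _) => s1 s2 /andP[? ?] /andP[? ?].
  by apply/andP; split; nra.
apply: (@approximable_cvg (fun n t => ind0 t * (1 - y t ^+ n) ^+ (2 ^ n)) _ ind0).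
- move=> n; apply: approximable_trigpoly; apply: trigpolyX.
  apply: (@eq_trigpoly _ b (fun t => 1 + -1 * y t ^+ n)); first by move=> t; ring.
  by apply: trigpolyD; [exact: trigpoly_cst|apply/trigpolyZ/trigpolyX].
- exact: measurable_ind.
- exact: L2_ind.
- move=> n t; rewrite normrM; have /andP[h1 h2] := step_ge0_le1 n (y01 t).
  by rewrite -[X in _ <= X]mulr1 ler_wpM2l // ger0_norm.
- move=> t; rewrite !ger0_norm ?ind_ge0 // (ind_split _ (ltW pq) qb).
  by rewrite lerDl ind_ge0.
(* At [p] and [q] the value of [y] is [1/2], where neither limit applies. *)
- exists ([set p] `|` [set q]); split.
  + by apply: measurableU.
  + apply: countable_lebesgue_measure0; apply: finite_set_countable.
    by rewrite finite_setU.
  + move=> t nt; apply: contrapT => tpq; apply: nt => /=.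
    have tp : t != p by apply/eqP => E; apply: tpq; left.
    have tq : t != q by apply/eqP => E; apply: tpq; right.
    have [/andP[h1 h2]|out] := boolP ((p <= t) && (t < p + b)); last first.
      rewrite /ind (negbTE out).
      have -> : (p <= t) && (t < q) = false.
        by apply/negbTE; apply: contra out => /andP[-> tq'] /=; apply: lt_le_trans qb.
      by under eq_fun do rewrite mul0r; exact: cvg_cst.
    have pt : p < t by rewrite lt_neqAle eq_sym tp h1.
    have s1 : 0 < sin (pi * (t - p) / b) by apply: pi_div_lt; lra.
    have -> : ind p (p + b) t = 1 by rewrite /ind h1 h2.
    under eq_fun do rewrite mul1r.
    case: (ltP t q) => tq'.
      have -> : ind p q t = 1 by rewrite /ind h1 tq'.
      have s2 : 0 < sin (pi * (q - t) / b) by apply: pi_div_lt; lra.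
      apply: step_cvg1; first by case/andP: (y01 t).
      by rewrite /y; have := mulr_gt0 s1 s2; lra.
    have qt : q < t by rewrite lt_neqAle eq_sym tq tq'.
    have -> : ind p q t = 0 by rewrite /ind h1 ltNge tq'.
    have s2 : 0 < sin (pi * (t - q) / b) by apply: pi_div_lt; lra.
    apply: step_cvg0; last by case/andP: (y01 t).
    have E : sin (pi * (q - t) / b) = - sin (pi * (t - q) / b).
      by rewrite -sinN; congr sin; ring.
    by rewrite /y E; have := mulr_gt0 s1 s2; lra.
Qed.

(** A Dynkin system argument: the rays []-oo, x[] generate the measurable sets and are stable under
    intersection, and inside the period a ray is empty or an interval from [p]. *)
Lemma approximable_set (A : set R) : measurable A ->
  approximable (fun t => ind0 t * \1_A t).
Proof.
pose H := [set A : set R | measurable A /\ approximable (fun t => ind0 t * \1_A t)].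
suff : (@measurable _ (measurableTypeR R)) `<=` H by move=> h /h[].
clear A.
have HT : H setT.
  split => //; have := @approximable_itv (p + b); rewrite ltrDl b_gt0 lexx => /(_ isT isT).
  congr approximable; apply/funext => t.
  by rewrite indicE in_setT mulr1.
rewrite [X in X `<=` _](RGenInftyO.measurableE R).
apply: lambda_system_subset => //.
- move=> _ _ [x ->] [y ->]; exists (Num.min x y).
  by apply/seteqP; split => t /=; rewrite !in_itv /= lt_min; [case=> -> ->|case/andP].
- split => //.
  + move=> A B BA [mA aA] [mB aB]; split; first exact: measurableD.
    have := approximableD aA (approximableZ (-1) aB); congr approximable.
    apply/funext => t; rewrite !indicE in_setD.
    have := BA t; case: (boolP (t \in B)); case: (boolP (t \in A)); rewrite ?inE /=.
    * by move=> _ _ _; ring.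
    * by move=> nA tB /(_ tB) /mem_set; rewrite (negbTE nA).
    * by move=> _ _ _; ring.
    * by move=> _ _ _; ring.
  + move=> F ndF HF; split; first by apply: bigcupT_measurable => n; case: (HF n).
    apply: (@approximable_cvg (fun n t => ind0 t * \1_(F n) t) _ ind0).
    * by move=> n; case: (HF n).
    * apply: measurable_funM; first exact: measurable_ind.
      by apply: measurable_indic; apply: bigcupT_measurable => n; case: (HF n).
    * exact: L2_ind.
    * move=> n t; rewrite normrM -[X in _ <= X]mulr1 ler_wpM2l // indicE.
      by case: (_ \in _); rewrite ?normr1 ?normr0.
    * move=> t; rewrite normrM -[X in _ <= X]mulr1 ler_wpM2l // indicE.
      by case: (_ \in _); rewrite ?normr1 ?normr0.
    * apply: aeW => t; apply: cvgM; first exact: cvg_cst.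
      have [[n _ Fn]|nF] := pselect ((\bigcup_n F n) t); last first.
        rewrite indicE memNset // (_ : (fun n => _) = fun=> 0); first exact: cvg_cst.
        apply/funext => n; rewrite indicE memNset // => h; apply: nF; by exists n.
      rewrite indicE mem_set; last by exists n.
      apply: cvg_near_cst; exists n => // m /= nm; rewrite indicE mem_set //.
      by have := ndF _ _ nm => /subsetPset/(_ t); apply.
- move=> _ [x ->]; split; first exact: measurable_itv.
  have [xp|px] := leP x p.
    have := approximableZ 0 HT.2; congr approximable; apply/funext => t.
    rewrite mul0r /ind; have [pt|//] := boolP (p <= t); last by rewrite mul0r.
    rewrite indicE memNset ?mulr0 //= in_itv /= => tx; lra.
  have := @approximable_itv (Num.min x (p + b)).
  rewrite lt_min px ltrDl b_gt0 ge_min lexx orbT => /(_ isT isT); congr approximable.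
  apply/funext => t; rewrite /ind lt_min indicE.
  have -> : (t \in `]-oo, x[%classic) = (t < x) by apply/idP/idP; rewrite inE /= in_itv.
  by case: (p <= t); case: (t < x); case: (t < p + b); rewrite /= ?mulr0 ?mul0r ?mulr1.
Qed.

Import HBNNSimple.

Lemma approximable_nneg u : L2real u -> (forall t, 0 <= u t) ->
  approximable (fun t => ind0 t * u t).
Proof.
move=> Lu u0; have [mu_ _] := Lu.
have mEu : measurable_fun setT (EFin \o u) by exact/measurable_EFinP.
have u0' t : setT t -> (0 <= (EFin \o u) t)%E by move=> _; rewrite lee_fin.
pose f := nnsfun_approx measurableT mEu.
have fu n t : `|f n t| <= u t.
  rewrite ger0_norm //; have := @le_approx _ _ _ setT (EFin \o u) n t u0' I.
  by rewrite lee_fin /f nnsfun_approxE.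
apply: (@approximable_cvg (fun n t => ind0 t * f n t) _ u).
- move=> n.
  rewrite (_ : (fun t => _) = fun t => \sum_(k <- finmap.enum_fset (fset_set (range (f n))))
    k * (ind0 t * \1_(f n @^-1` [set k]) t)); last first.
    apply/funext => t; rewrite {1}fimfunE fsbig_finite //=; rewrite mulr_sumr.
    by apply: eq_bigr => k _; ring.
  by apply: approximable_sum => k; apply: approximableZ; apply: approximable_set.
- by apply: measurable_funM => //; exact: measurable_ind.
- exact: Lu.
- move=> n t; rewrite normrM [`|u t|]ger0_norm // -[X in _ <= X]mul1r ler_pM //.
  exact: ind_norm.
- move=> t; rewrite normrM -[X in _ <= X]mul1r ler_pM //; exact: ind_norm.
- apply: aeW => t; apply: cvgM; first exact: cvg_cst.
  have := @cvg_nnsfun_approx _ _ _ _ measurableT _ mEu u0' t I.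
  by move=> /fine_cvg.
Qed.

Lemma approximable_L2 u : L2real u -> approximable (fun t => ind0 t * u t).
Proof.
move=> Lu; have [mu_ _] := Lu.
have Lp (v : R -> R) : L2real v -> L2real (fun t => Num.max (v t) 0).
  move=> Lv; apply: (L2_dom _ _ Lv).
    by apply: measurable_maxr => //; case: Lv.
  move=> t; case: (leP (v t) 0) => h; rewrite ?normr0 //.
have a1 := approximable_nneg (Lp _ Lu) (fun t => _).
have a2 := approximable_nneg (Lp _ (L2Z (-1) Lu)) (fun t => _).
have m0 (x : R) : 0 <= Num.max x 0 by rewrite le_max lexx orbT.
have := approximableD (a1 (fun t => m0 _)) (approximableZ (-1) (a2 (fun t => m0 _))).
congr approximable; apply/funext => t.
have E : Num.max (u t) 0 - Num.max (-1 * u t) 0 = u t.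
  by case: (leP (u t) 0) => h1; case: (leP (-1 * u t) 0) => h2; lra.
by rewrite -[in RHS]E; ring.
Qed.

(** The degree of the approximating polynomial depends on [e], so the coefficient sums have to be
    bounded for every [N]. *)
Lemma parseval_le u M : L2real u ->
  (forall N, \sum_(n < N) wcoef2 b p 1 u n <= M) ->
  sqn (fun t => ind0 t * u t) <= 2 / b * M.
Proof.
move=> Lu uM; have [LG aG] := approximable_L2 Lu.
apply/ler_addgt0Pl => e e0; have [P [[N [x PE]] GP]] := aG e e0.
have := sqnorm_le_trig b_gt0 p (isT : (0 < 1)%N) LG PE; rewrite mul1r => h.
apply: le_trans h _; apply: lerD; first exact: ltW.
rewrite ler_wpM2l ?divr_ge0 ?(ltW b_gt0) //; apply: le_trans (uM N).
rewrite le_eqVlt; apply/orP; left; apply/eqP; apply: eq_bigr => n _.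
rewrite /wcoef2 mul1r; congr (_ ^+ 2 + _ ^+ 2); apply: eq_rint => t;
by rewrite [_ * u t]mulrC -mulrA; congr (_ * _); rewrite mulrA ind_sqr.
Qed.

End Density.

(** * From trivial null vectors to frame bounds *)

Section EsumBounds.
Variable R : realType.

Lemma esum_le_seq (T : choiceType) (q : T -> R) (M : R) :
  (forall s : seq T, uniq s -> \sum_(i <- s) q i <= M) ->
  (\esum_(i in [set: T]) (q i)%:E <= M%:E)%E.
Proof.
move=> H; apply: ub_ereal_sup => _ [F [finF _] <-].
rewrite fsbig_finite //= sumEFin lee_fin; apply: H; exact: finmap.fset_uniq.
Qed.

Lemma seq_le_esum (T : choiceType) (q : T -> \bar R) (s : seq T) :
  (forall i, 0 <= q i)%E -> uniq s -> (\sum_(i <- s) q i <= \esum_(i in [set: T]) q i)%E.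
Proof.
move=> q0 us; rewrite fsbig_seq //; apply: ereal_sup_ubound; by exists [set` s].
Qed.

(** Nonnegative and negative indices contribute at most [M] each, the latter by evenness. *)
Lemma esum_even_le (q : int -> R) (M : R) : (forall n, 0 <= q n) ->
  (forall n, q (- n) = q n) -> (forall N, \sum_(n < N) q n%:Z <= M) ->
  (\esum_(n in [set: int]) (q n)%:E <= (2 * M)%:E)%E.
Proof.
move=> q0 qN qM; apply: esum_le_seq => s us.
pose N := (\sum_(n <- s) `|n|)%N.+1.
have sN n : n \in s -> (`|n| < N)%N.
  by move=> ns; rewrite /N ltnS (bigD1_seq n) //= leq_addr.
rewrite (bigID (fun n : int => 0 <= n)) /= mulrDl mul1r.
have le (s' : seq int) : uniq s' -> (forall n, n \in s' -> (0 <= n) && (`|n| < N)%N) ->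
    \sum_(n <- s') q n <= M.
  move=> us' s'N; apply: le_trans (qM N).
  rewrite -(big_mkord xpredT (fun n => q n%:Z)) -(big_map Posz xpredT q).
  have up : uniq [seq Posz i | i <- index_iota 0 N].
    by rewrite map_inj_uniq ?iota_uniq // => i j [].
  have sub : {subset s' <= [seq Posz i | i <- index_iota 0 N]}.
    move=> n /s'N /andP[n0 nN]; apply/mapP; exists `|n|%N; last by lia.
    by rewrite mem_index_iota.
  have pe : perm_eq [seq x <- [seq Posz i | i <- index_iota 0 N] | x \in s'] s'.
    apply: uniq_perm => //; first exact: filter_uniq.
    by move=> x; rewrite mem_filter; case: (boolP (x \in s')) => // /sub ->.
  rewrite -(perm_big _ pe).
  rewrite big_filter [X in _ <= X](bigID (fun n => n \in s')) /= lerDl.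
  exact: sumr_ge0.
apply: lerD.
  rewrite -big_filter; apply: le; first exact: filter_uniq.
  by move=> n; rewrite mem_filter => /andP[-> /sN ->].
rewrite -big_filter; under eq_bigr do rewrite -qN.
rewrite -(big_map -%R xpredT q); apply: le.
  by rewrite map_inj_uniq ?filter_uniq //; exact: oppr_inj.
by move=> _ /mapP[n + ->]; rewrite mem_filter => /andP[n0 /sN nN]; lia.
Qed.

End EsumBounds.

Lemma cell_bounds (R : realType) (p t b l k : R) : 0 < b -> - l <= k -> k <= l ->
  k * b <= t - p -> t - p < k * b + b ->
  p - l * b <= t /\ t < p - l * b + (l * 2 + 1) * b.
Proof.
move=> b0 k1 k2 h1 h2.
by have := ler_wpM2r (ltW b0) k1; have := ler_wpM2r (ltW b0) k2; split; lra.
Qed.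

(** * Reduction to real functions and the upper frame bound *)

Section Frame.
Variables (R : realType) (a b c : R).
Hypotheses (a_gt0 : 0 < a) (ltab : a < b) (ltbc : b < c).
Let b_gt0 : 0 < b. Proof. exact: lt_trans ltab. Qed.
Let c_gt0 : 0 < c. Proof. exact: lt_trans ltbc. Qed.

Implicit Types u v : R -> R.

Definition chim (m : int) (t : R) : R := ind (m%:~R * a) (m%:~R * a + c) t.

Lemma chimE m t : chi c (t - m%:~R * a) = chim m t.
Proof. by rewrite /chi /chim /ind subr_ge0 ltrBlDl; case: ifP. Qed.

Definition gcoef (e : bool) (u : R -> R) (m n : int) : R :=
  ip u (fun t => chim m t * trigw b e n t).
Definition gcoef2 u m n : R := gcoef true u m n ^+ 2 + gcoef false u m n ^+ 2.
Definition gsum (u : R -> R) : \bar R :=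
  \esum_(m in [set: int]) \esum_(n in [set: int]) (gcoef2 u m n)%:E.

Lemma gcoef2_ge0 u m n : 0 <= gcoef2 u m n.
Proof. by rewrite addr_ge0 ?sqr_ge0. Qed.

Lemma gcoefNt u m n : gcoef true u m (- n) = gcoef true u m n.
Proof. by apply: eq_rint => t; rewrite /= coswN. Qed.

Lemma L2_chim_trigw m e n : L2real (fun t => chim m t * trigw b e n t).
Proof. exact: L2_ind_trigw. Qed.

Lemma gcoefNf u m n : L2real u -> gcoef false u m (- n) = - gcoef false u m n.
Proof.
move=> Lu; rewrite -[RHS]mulN1r /gcoef -ipZl //; last exact: L2_chim_trigw.
by apply: eq_rint => t; rewrite /= sinwN; ring.
Qed.

Lemma gcoef2N u m n : L2real u -> gcoef2 u m (- n) = gcoef2 u m n.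
Proof. by move=> Lu; rewrite /gcoef2 gcoefNt gcoefNf // sqrrN. Qed.

Lemma L2norm2E u v : L2real u -> L2real v -> L2norm2 u v = sqn u + sqn v.
Proof.
move=> Lu Lv; rewrite /sqn /ip -rintD; try exact: L2_mul.
by apply: eq_rint => t; rewrite -!expr2.
Qed.

Lemma gabor_reE u v m n : L2real u -> L2real v ->
  gabor_re (chi c) a b u v m n = gcoef true u m n - gcoef false v m n.
Proof.
move=> Lu Lv; rewrite -[X in _ - X]mul1r -mulNr /gcoef -ipZl //; last exact: L2_chim_trigw.
rewrite -rintD; last 2 first.
- by apply: L2_mul => //; exact: L2_chim_trigw.
- by apply: L2_mul; [exact: L2Z|exact: L2_chim_trigw].
by apply: eq_rint => t; rewrite chimE /= /cosw /sinw; ring.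
Qed.

Lemma gabor_imE u v m n : L2real u -> L2real v ->
  gabor_im (chi c) a b u v m n = gcoef false u m n + gcoef true v m n.
Proof.
move=> Lu Lv; rewrite -rintD; last 2 first.
- by apply: L2_mul => //; exact: L2_chim_trigw.
- by apply: L2_mul => //; exact: L2_chim_trigw.
by apply: eq_rint => t; rewrite chimE /= /cosw /sinw; ring.
Qed.

Lemma gsumE u : gsum u = (\esum_(mn in [set: int * int]) (gcoef2 u mn.1 mn.2)%:E)%E.
Proof.
rewrite /gsum esum_esum; last by move=> *; rewrite lee_fin gcoef2_ge0.
by congr esum; apply/seteqP; split.
Qed.

(* The cross terms of the moduli at [n] and [- n] cancel. *)
Lemma gabor_esumE u v : L2real u -> L2real v ->
  let E := (\esum_(mn in [set: int * int])
     ((gabor_re (chi c) a b u v mn.1 mn.2) ^+ 2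
      + (gabor_im (chi c) a b u v mn.1 mn.2) ^+ 2)%:E)%E in
  (E + E = (gsum u + gsum v) + (gsum u + gsum v))%E.
Proof.
move=> Lu Lv E.
pose F (mn : int * int) := ((gabor_re (chi c) a b u v mn.1 mn.2) ^+ 2
      + (gabor_im (chi c) a b u v mn.1 mn.2) ^+ 2)%:E.
have F0 mn : (0 <= F mn)%E by rewrite lee_fin addr_ge0 ?sqr_ge0.
have EN : E = (\esum_(mn in [set: int * int]) F (mn.1, (- mn.2)%R))%E.
  rewrite /E (@reindex_esum R _ _ setT setT (fun mn : int * int => (mn.1, - mn.2))) //.
  split => //.
    by move=> [m n] [m' n'] _ _ /= [-> /oppr_inj ->].
  by move=> [m n] _; exists (m, - n) => //=; rewrite opprK.
rewrite {2}EN /E -esumD //; last by move=> *; exact: F0.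
have g0 w mn : (0 <= (gcoef2 w mn.1 mn.2)%:E)%E by rewrite lee_fin gcoef2_ge0.
rewrite !gsumE -!esumD //; last 2 first.
- by move=> *; rewrite adde_ge0.
- by move=> *; rewrite adde_ge0.
apply: eq_esum => -[m n] _ /=; rewrite -!EFinD; congr _%:E.
rewrite !gabor_reE // !gabor_imE // !gcoefNt !gcoefNf // /gcoef2; ring.
Qed.

(** Squared norm and Gabor sum are additive over real and imaginary parts, so the real bounds add
    up; conversely [v = 0] recovers them. The doubled identity is halved by cases on the extended
    reals. *)
Lemma gabor_frame_real : gabor_frame (chi c) a b <->
  exists A B : R, 0 < A /\ A <= B /\ forall u, L2real u ->
    ((A * sqn u)%:E <= gsum u)%E /\ (gsum u <= (B * sqn u)%:E)%E.
Proof.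
have sq0 : sqn (fun=> 0) = 0 :> R.
  by rewrite /sqn /ip; under eq_rint do rewrite mulr0; exact: rint0.
have gsum0 : gsum (fun=> 0) = 0%E.
  rewrite gsumE esum1 // => mn _.
  have g0 e m n : gcoef e (fun=> 0) m n = 0.
    by rewrite -[RHS]rint0; apply: eq_rint => t; rewrite mul0r.
  by rewrite /gcoef2 !g0 expr0n addr0.
have g0 u : (0 <= gsum u)%E.
  by apply: esum_ge0 => m _; apply: esum_ge0 => n _; rewrite lee_fin gcoef2_ge0.
split=> -[A [B [A0 [AB H]]]]; exists A, B; split => //; split => //.
  move=> u Lu; have := H u _ Lu (L20 R); rewrite L2norm2E //; last exact: L20.
  rewrite sq0 addr0; have := gabor_esumE Lu (L20 R); rewrite gsum0 adde0 /=.
  set E := esum _ _; move: (g0 u); move: E (gsum u) => [x| |] [y| |] //= y0.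
  by rewrite -!EFinD => -[xy]; have -> : x = y by lra.
move=> u v Lu Lv; have [u1 u2] := H u Lu; have [v1 v2] := H v Lv.
rewrite L2norm2E // !mulrDr; have := gabor_esumE Lu Lv => /=.
set E := esum _ _; have uv1 := leeD u1 v1; have uv2 := leeD u2 v2.
move: uv1 uv2; rewrite -!EFinD; move: (gsum u + gsum v)%E E => [y| |] [x| |] //=.
by rewrite !lee_fin => h1 h2; rewrite -!EFinD => -[xy]; split; lra.
Qed.

(** Once [c < P a], a window [[m a, m a + c[] containing [t] has [m] among the [P] integers ending
    at [floor (t / a)]. *)
Lemma chim_count : exists P : nat, forall (s : seq int) t, uniq s ->
  \sum_(m <- s) chim m t <= P%:R.
Proof.
have q0 : 0 <= c / a by rewrite divr_ge0 ?ltW.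
have [P cP] : exists P : nat, c < P%:R * a.
  by exists (Num.bound (c / a)); rewrite -ltr_pdivrMr // archi_boundP.
exists P => s t us.
pose A (m : int) := (m%:~R * a <= t) && (t < m%:~R * a + c).
have -> : \sum_(m <- s) chim m t = (size (seq.filter A s))%:R.
  rewrite size_filter -sum1_count natr_sum [RHS]big_mkcond /=.
  by apply: eq_bigr => m _; rewrite /chim /ind /A; case: (_ && _).
rewrite ler_nat -(size_iota 0 P) -(size_map (fun i => Num.floor (t / a) - i%:Z)).
apply: uniq_leq_size; first exact: filter_uniq.
move=> m; rewrite mem_filter => /andP[/andP[h1 h2] _].
have := floor_itv (t / a); rewrite rmorphD /= => /andP[f1 f2].
rewrite ler_pdivlMr // in f1; rewrite ltr_pdivrMr // mulrDl mul1r in f2.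
have mf : m <= Num.floor (t / a) by rewrite floor_ge_int ler_pdivlMr.
have fm : Num.floor (t / a) - m < P%:Z.
  rewrite -(ltr_int R) rmorphB /= -(ltr_pM2r a_gt0) mulrBl -pmulrn; lra.
apply/mapP; exists `|(Num.floor (t / a) - m)%R|%N; last by lia.
by rewrite mem_iota; lia.
Qed.

Lemma L2_chimM m u : L2real u -> L2real (fun t => chim m t * u t).
Proof.
by move=> Lu; apply: (@L2_mulbd _ 1) => //; [exact: measurable_ind|exact: ind_norm].
Qed.

(** For fixed [m] the coefficients are trigonometric coefficients of [chim m * u], supported in [Q]
    periods with [Q b > c]. Bessel bounds their sum, and the bounded overlap of the windows allows
    summing over [m]. *)
Lemma gsum_upper : exists B : R, 0 < B /\ forall u, L2real u ->
  (gsum u <= (B * sqn u)%:E)%E.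
Proof.
have [P Pcount] := chim_count.
have q0 : 0 <= c / b by rewrite divr_ge0 ?ltW.
have [Q cQ] : exists Q : nat, c < Q%:R * b.
  by exists (Num.bound (c / b)); rewrite -ltr_pdivrMr // archi_boundP.
have Q0 : (0 < Q)%N.
  by rewrite -(ltr0n R) -(pmulr_lgt0 _ b_gt0); exact: lt_trans cQ.
(* The 2 pays for the negative frequencies; [P.+1] in place of [P] makes positivity immediate. *)
exists (2 * (Q%:R * b) * P.+1%:R); split; first by rewrite !mulr_gt0 ?ltr0n.
move=> u Lu.
have inner m : (\esum_(n in [set: int]) (gcoef2 u m n)%:E <=
    (2 * (Q%:R * b * sqn (fun t => chim m t * u t)))%:E)%E.
  apply: esum_even_le => [n|n|N]; [exact: gcoef2_ge0|exact: gcoef2N|].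
  have := bessel_trig b_gt0 (m%:~R * a) N Q0 (L2_chimM m Lu).
  have chiQ t : ind (m%:~R * a) (m%:~R * a + Q%:R * b) t * chim m t = chim m t.
    rewrite /chim /ind; case: (m%:~R * a <= t); rewrite /= ?mulr0 //.
    case: (ltP t (_ + c)) => h2; rewrite ?mulr0 //.
    by rewrite (lt_trans h2) ?mulr1 // ltrD2l.
  have E e n : ip (fun t => chim m t * u t)
      (fun t => ind (m%:~R * a) (m%:~R * a + Q%:R * b) t * trigw b e n t) = gcoef e u m n.
    by apply: eq_rint => t; rewrite -[in RHS](chiQ t); ring.
  rewrite (eq_bigr (fun n : 'I_N => gcoef2 u m n%:Z)); last first.
    by move=> n _; rewrite /wcoef2 !E.
  move=> /le_trans; apply; rewrite ler_wpM2l ?mulr_ge0 ?(ltW b_gt0) //.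
  rewrite le_eqVlt; apply/orP; left; apply/eqP; apply: eq_rint => t.
  by rewrite [ind _ _ t * (_ * _)]mulrA chiQ.
apply: (@le_trans _ _ (\esum_(m in [set: int])
    (2 * (Q%:R * b * sqn (fun t => chim m t * u t)))%:E)%E).
  by apply: le_esum.
apply: esum_le_seq => s us.
have -> : 2 * (Q%:R * b) * P.+1%:R * sqn u = 2 * (Q%:R * b * (P.+1%:R * sqn u)) by ring.
rewrite -mulr_sumr ler_wpM2l // -mulr_sumr ler_wpM2l ?mulr_ge0 ?(ltW b_gt0) //.
have int2 m : intg (fun t => chim m t * u t * (chim m t * u t)).
  by apply: L2_mul; exact: L2_chimM.
rewrite /sqn /ip -rint_sum // -rintZ; last exact: L2_mul.
apply: le_rint; first exact: intg_sum.
  by apply: intgZ; exact: L2_mul.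
move=> t; rewrite (eq_bigr (fun m => chim m t * (u t * u t))); last first.
  by move=> m _; rewrite mulrACA ind_sqr.
rewrite -mulr_suml ler_wpM2r -?expr2 ?sqr_ge0 //.
by apply: le_trans (Pcount s t us) _; rewrite ler_nat.
Qed.

Lemma ind_telescope (l p t : R) (n : nat) : 0 < l ->
  \sum_(k < n) ind (p + k%:R * l) (p + k%:R * l + l) t = ind p (p + n%:R * l) t.
Proof.
move=> l0; elim: n => [|n IH].
  rewrite big_ord0 mul0r addr0 /ind; case: leP => //= pt; by rewrite ltNge pt.
rewrite big_ord_recr /= IH; have -> : p + n%:R * l + l = p + n.+1%:R * l.
  by rewrite -natr1; ring.
by rewrite -ind_split // ?lerD2l ?ler_wpM2r ?ler_nat ?(ltW l0) // lerDl mulr_ge0 // ltW.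
Qed.

Lemma sqn_exhaust u M : L2real u ->
  (forall N : nat, sqn (fun t => ind (- N%:R * a) (N%:R * a) t * u t) <= M) -> sqn u <= M.
Proof.
move=> Lu H; rewrite leNgt; apply/negP => Mu.
have cv : sqn (fun t => ind (- N%:R * a) (N%:R * a) t * u t) @[N --> \oo] --> sqn u.
  apply: (@rint_dct _ _ _ (fun t => u t * u t)).
  - move=> N; apply: measurable_funM; apply: measurable_funM;
      try exact: measurable_ind; exact: (L2_meas Lu).
  - by apply: measurable_funM; exact: (L2_meas Lu).
  - exact: L2_mul.
  - move=> N t; rewrite mulrACA ind_sqr normrM [`|u t * u t|]ger0_norm -?expr2 ?sqr_ge0 //.
    by rewrite -[X in _ <= X]mul1r ler_wpM2r ?sqr_ge0 // ind_norm.
  - apply: aeW => t; apply: cvg_near_cst.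
    exists (Num.bound (`|t| / a)) => // N /= tN.
    have : `|t| < N%:R * a.
      rewrite -ltr_pdivrMr //; apply: lt_le_trans (_ : (Num.bound (`|t| / a))%:R <= _).
        by apply: archi_boundP; rewrite divr_ge0 // ltW.
      by rewrite ler_nat.
    rewrite ltr_norml mulrACA ind_sqr => /andP[h1 h2].
    by rewrite /ind mulNr h2 (ltW h1) mul1r.
have Mu' : 0 < sqn u - M by lra.
move/cvgrPdist_lt: cv => /(_ _ Mu')[N _ /(_ N (leqnn N)) /=].
by have := H N; rewrite ltr_norml => h /andP[h1 h2]; lra.
Qed.

Lemma sqn_indM p q u : sqn (fun t => ind p q t * u t) = rint (fun t => ind p q t * (u t * u t)).
Proof. by apply: eq_rint => t; rewrite mulrACA ind_sqr. Qed.

(** * The lower frame bound *)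

Section Lower.
Variables (K L : nat) (C : R).
Hypothesis C_ge0 : 0 <= C.
Hypothesis HL : forall (j k : int) t, (`|j| <= K)%N -> 0 <= t < b ->
    chi c (t - j%:~R * a + k%:~R * b) != 0 -> (`|k| <= L)%N.
Hypothesis HC : forall t (x : int -> R), 0 <= t < a ->
    x 0 ^+ 2 <= C * \sum_(j < K.*2.+1) (\sum_(k < L.*2.+1)
      chi c (t - (j%:Z - K%:Z)%:~R * a + (k%:Z - L%:Z)%:~R * b) * x (k%:Z - L%:Z)) ^+ 2.
Variable u : R -> R.
Hypothesis Lu : L2real u.

(** Row [m] of the matrix at time [s], applied to the samples [u (s + k b)] with [|k| <= L];
    equally, a sum of translates of [chim m * u] by multiples of [b]. The first reading meets [HC],
    the second Fourier coefficients. *)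
Definition periodized (m : int) (s : R) : R :=
  \sum_(k < L.*2.+1) (chim m (s + (k%:Z - L%:Z)%:~R * b) * u (s + (k%:Z - L%:Z)%:~R * b)).

Lemma L2_periodized m : L2real (periodized m).
Proof.
apply: L2_sum => k; exact: (@L2_shift _ (fun s => chim m s * u s)) (L2_chimM m Lu).
Qed.

Lemma intg_chim_trigw m e n p q :
  intg (fun t => chim m t * u t * (ind p q t * trigw b e n t)).
Proof. by apply: L2_mul; [exact: L2_chimM|exact: L2_ind_trigw]. Qed.

(** As [trigw] has period [b], the integrals over shifted cells join to one over [2 L + 1]
    consecutive periods; [HL] shows that these cover the window of the row. *)
Lemma periodized_coef (i : int) (j : 'I_K.*2.+1) e n :
  ip (periodized (i + (j%:Z - K%:Z)))
     (fun t => ind (i%:~R * a) (i%:~R * a + b) t * trigw b e n t) =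
  gcoef e u (i + (j%:Z - K%:Z)) n.
Proof.
set m := i + _; set p := i%:~R * a.
pose h (k : 'I_L.*2.+1) (t : R) := chim m t * u t *
  (ind (p + (k%:Z - L%:Z)%:~R * b) (p + b + (k%:Z - L%:Z)%:~R * b) t * trigw b e n t).
have ih k : intg (h k) by exact: intg_chim_trigw.
transitivity (\sum_(k < L.*2.+1) rint (h k)).
  rewrite ip_suml; last 2 first.
  - by move=> k; exact: (@L2_shift _ (fun s => chim m s * u s)) (L2_chimM m Lu).
  - exact: L2_ind_trigw.
  apply: eq_bigr => k _; rewrite -(rint_shift ((k%:Z - L%:Z)%:~R * b) (ih k)).
  apply: eq_rint => t; rewrite /h ind_shift; congr (_ * (_ * _)).
  have [h1 h2] := trigw_period b_gt0 n (k%:Z - L%:Z) t.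
  by rewrite /trigw h1 h2.
rewrite -rint_sum //; apply: eq_rint => t.
transitivity (chim m t * u t * trigw b e n t *
   ind (p - L%:R * b) (p - L%:R * b + L.*2.+1%:R * b) t).
  rewrite -ind_telescope // mulr_sumr; apply: eq_bigr => k _; rewrite /h.
  have -> : p + (k%:Z - L%:Z)%:~R * b = p - L%:R * b + k%:R * b.
    by rewrite rmorphB /= -!pmulrn; ring.
  have -> : p + b + (k%:Z - L%:Z)%:~R * b = p - L%:R * b + k%:R * b + b.
    by rewrite rmorphB /= -!pmulrn; ring.
  by ring.
have [c0|c1] := eqVneq (chim m t) 0; first by rewrite c0 !(mul0r, mulr0).
suff -> : ind (p - L%:R * b) (p - L%:R * b + L.*2.+1%:R * b) t = 1 by ring.
pose k := Num.floor ((t - p) / b).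
have := floor_itv ((t - p) / b); rewrite -/k rmorphD /= => /andP[f1 f2].
rewrite ler_pdivlMr // in f1; rewrite ltr_pdivrMr // mulrDl mul1r in f2.
have kL : (`|k| <= L)%N.
  apply: (@HL (j%:Z - K%:Z) k (t - p - k%:~R * b)).
  - by have := ltn_ord j; lia.
  - by apply/andP; split; lra.
  - move: c1; rewrite -chimE; congr (chi _ _ != 0).
    by rewrite /m /p rmorphD /=; ring.
have k1 : - L%:R <= k%:~R :> R.
  by rewrite pmulrn -rmorphN /= ler_int; lia.
have k2 : k%:~R <= L%:R :> R by rewrite pmulrn ler_int; lia.
have [h1 h2] := cell_bounds b_gt0 k1 k2 f1 f2.
have E : L.*2.+1%:R = L%:R * 2 + 1 :> R by rewrite -natr1 -muln2 natrM.
by rewrite /ind E h1 h2.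
Qed.

Lemma sqn_periodized i (j : 'I_K.*2.+1) M :
  (\esum_(n in [set: int]) (gcoef2 u (i + (j%:Z - K%:Z)) n)%:E <= M%:E)%E ->
  sqn (fun t => ind (i%:~R * a) (i%:~R * a + b) t * periodized (i + (j%:Z - K%:Z)) t)
    <= 2 / b * M.
Proof.
move=> eM; apply: parseval_le => //; first exact: L2_periodized.
move=> N; rewrite -lee_fin; apply: le_trans eM.
rewrite (eq_bigr (fun n : 'I_N => gcoef2 u (i + (j%:Z - K%:Z)) n%:Z)); last first.
  by move=> n _; rewrite /wcoef2 mul1r !periodized_coef.
rewrite -(big_mkord xpredT (fun n => gcoef2 u (i + (j%:Z - K%:Z)) n%:Z)).
rewrite -(big_map Posz xpredT (fun n => gcoef2 u (i + (j%:Z - K%:Z)) n)) -sumEFin.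
apply: seq_le_esum; first by move=> n; rewrite lee_fin gcoef2_ge0.
by rewrite map_inj_uniq ?iota_uniq // => p q [].
Qed.

(** [HC] for the samples [k |-> u (s + k b)] is integrated over a cell of length [a], the range of
    times it allows; on the right the cell is enlarged to a period [b], ready for Parseval. *)
Lemma sqn_cell i : sqn (fun t => ind (i%:~R * a) (i%:~R * a + a) t * u t) <=
  C * \sum_(j < K.*2.+1)
    sqn (fun t => ind (i%:~R * a) (i%:~R * a + b) t * periodized (i + (j%:Z - K%:Z)) t).
Proof.
pose F (j : 'I_K.*2.+1) t := ind (i%:~R * a) (i%:~R * a + b) t *
  periodized (i + (j%:Z - K%:Z)) t.
have LF j : L2real (F j) by apply: L2_ind0M; exact: L2_periodized.
rewrite /sqn /ip -rint_sum; last by move=> j; exact: L2_mul (LF j) (LF j).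
rewrite -rintZ; last by apply: intg_sum => j; exact: L2_mul (LF j) (LF j).
apply: le_rint.
- apply: L2_mul; apply: (@L2_mulbd _ 1) => //; try exact: measurable_ind; exact: ind_norm.
- by apply: intgZ; apply: intg_sum => j; exact: L2_mul (LF j) (LF j).
move=> s; have [/andP[h1 h2]|out] := boolP ((i%:~R * a <= s) && (s < i%:~R * a + a)); last first.
  rewrite {1 2}/ind (negbTE out) !mul0r mulr_ge0 // sumr_ge0 // => j _.
  by rewrite -expr2 sqr_ge0.
have E1 : ind (i%:~R * a) (i%:~R * a + a) s = 1 by rewrite /ind h1 h2.
have E2 : ind (i%:~R * a) (i%:~R * a + b) s = 1.
  by rewrite /ind h1 (lt_trans h2) // ltrD2l.
have := @HC (s - i%:~R * a) (fun k => u (s + k%:~R * b)).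
rewrite E1 mul0r addr0 mul1r => H.
rewrite -expr2; apply: le_trans (H _) _; first by apply/andP; split; lra.
rewrite ler_wpM2l //; apply: ler_sum => j _.
rewrite E2 !mul1r -expr2 /periodized le_eqVlt; apply/orP; left; apply/eqP.
congr (_ ^+ 2); apply: eq_bigr => k _; congr (_ * _).
by rewrite -chimE; congr chi; rewrite rmorphD /=; ring.
Qed.

(** An infinite Gabor sum is set apart because [C] may be 0 and [0 * +oo = 0]. *)
Lemma gsum_lower_aux : ((sqn u)%:E <= (C * (2 / b) * K.*2.+1%:R)%:E * gsum u)%E \/ gsum u = +oo%E.
Proof.
have e0 m : (0 <= \esum_(n in [set: int]) (gcoef2 u m n)%:E)%E.
  by apply: esum_ge0 => n _; rewrite lee_fin gcoef2_ge0.
case E : (gsum u) => [g| |]; last 2 first.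
- by right.
- by have := @esum_ge0 R _ setT _ (fun m _ => e0 m); rewrite -/(gsum u) E.
left; rewrite -EFinM lee_fin.
pose em m := fine (\esum_(n in [set: int]) (gcoef2 u m n)%:E).
have emE m : (\esum_(n in [set: int]) (gcoef2 u m n)%:E = (em m)%:E)%E.
  rewrite fineK // ge0_fin_numE //; apply: (@le_lt_trans _ _ g%:E); last exact: ltry.
  rewrite -E; have := @seq_le_esum R _ (fun m => \esum_(n in [set: int]) (gcoef2 u m n)%:E) [:: m] e0 isT.
  by rewrite big_seq1.
have sum_em (s : seq int) : uniq s -> \sum_(m <- s) em m <= g.
  move=> us; rewrite -lee_fin -E -sumEFin.
  by have := seq_le_esum e0 us; under eq_bigr do rewrite emE.
apply: sqn_exhaust => // N.
have -> : sqn (fun t => ind (- N%:R * a) (N%:R * a) t * u t) =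
    \sum_(i < N.*2) sqn (fun t => ind ((i%:Z - N%:Z)%:~R * a) ((i%:Z - N%:Z)%:~R * a + a) t * u t).
  have ii p q : intg (fun t => ind p q t * (u t * u t)).
    apply: (intg_dom _ _ (L2_mul Lu Lu)).
      apply: measurable_funM; first exact: measurable_ind.
      by apply: measurable_funM; exact: (L2_meas Lu).
    move=> t; rewrite normrM [`|u t * u t|]ger0_norm -?expr2 ?sqr_ge0 //.
    by rewrite -[X in _ <= X]mul1r ler_wpM2r ?sqr_ge0 // ind_norm.
  rewrite sqn_indM; under eq_bigr do rewrite sqn_indM.
  rewrite -rint_sum //; apply: eq_rint => t; rewrite -mulr_suml; congr (_ * _).
  have := ind_telescope (- N%:R * a) t N.*2 a_gt0.
  have -> : - N%:R * a + N.*2%:R * a = N%:R * a by rewrite -muln2 natrM; ring.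
  move=> <-; apply: eq_bigr => i _.
  by rewrite rmorphB /= -!pmulrn; congr ind; ring.
have step (i : 'I_N.*2) : sqn (fun t => ind ((i%:Z - N%:Z)%:~R * a)
     ((i%:Z - N%:Z)%:~R * a + a) t * u t) <=
    C * (2 / b) * \sum_(j < K.*2.+1) em (i%:Z - N%:Z + (j%:Z - K%:Z)).
  apply: le_trans (sqn_cell _) _; rewrite -mulrA ler_wpM2l // mulr_sumr.
  by apply: ler_sum => j _; apply: sqn_periodized; rewrite emE.
apply: le_trans (ler_sum _ (fun i _ => step i)) _.
have D0 : 0 <= C * (2 / b).
  by apply: mulr_ge0 => //; apply: divr_ge0 => //; exact: ltW.
rewrite -mulr_sumr -[X in _ <= X]mulrA; apply: (ler_wpM2l D0).
(* For fixed [j], distinct cells [i] give distinct rows, so each of the [2 K + 1] inner sums is at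
   most [g]. *)
rewrite exchange_big /= mulr_natl -[X in _ <= _ *+ X]card_ord -sumr_const.
apply: ler_sum => j _.
rewrite -(big_mkord xpredT (fun i => em (i%:Z - N%:Z + (j%:Z - K%:Z)))).
rewrite -(big_map (fun i : nat => i%:Z - N%:Z + (j%:Z - K%:Z)) xpredT em).
by apply: sum_em; rewrite map_inj_uniq ?iota_uniq // => p q; lia.
Qed.

End Lower.

Lemma null_trivial_frame : null_trivial a b c -> gabor_frame (chi c) a b.
Proof.
move=> /(local_stability a_gt0 ltab ltbc)[K [L [C [C0 [HL HC]]]]].
have [B [B0 HB]] := gsum_upper.
apply/gabor_frame_real.
set D := C * (2 / b) * K.*2.+1%:R.
have D0 : 0 <= D.
  by apply: mulr_ge0 => //; apply: mulr_ge0 => //; apply: divr_ge0 => //; exact: ltW.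
have D1 : 0 < D + 1 by lra.
(* [D] may be 0, hence [D + 1]; the upper constant is enlarged so that it dominates the lower
   one. *)
exists (D + 1)^-1, (B + (D + 1)^-1); split; first by rewrite invr_gt0.
split; first by rewrite lerDr ltW.
move=> u Lu; have u0 : 0 <= sqn u by exact: ip_ge0.
split; last first.
  apply: le_trans (HB u Lu) _; by rewrite lee_fin ler_wpM2r // lerDl invr_ge0 ltW.
have [h|->] := gsum_lower_aux C0 HL HC Lu; last by rewrite leey.
have g0 : (0 <= gsum u)%E.
  by apply: esum_ge0 => m _; apply: esum_ge0 => n _; rewrite lee_fin gcoef2_ge0.
move: h g0; rewrite -/D; case: (gsum u) => [g| |] //; last by move=> _ _; rewrite leey.
by rewrite -EFinM !lee_fin => h g0; rewrite ler_pdivrMl // mulrDl mul1r (le_trans h) // lerDl.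
Qed.

End Frame.

(** * From frame bounds to trivial null vectors *)

Section FrameNull.
Variables (R : realType) (a b c : R).
Hypotheses (a_gt0 : 0 < a) (ltab : a < b) (ltbc : b < c).
Let b_gt0 : 0 < b. Proof. exact: lt_trans ltab. Qed.
Let c_gt0 : 0 < c. Proof. exact: lt_trans ltbc. Qed.
Local Notation lo := (win_lo a b).
Local Notation hi := (win_hi a b c).

Lemma window_size : exists Q : nat, forall t j, hi t j - lo t j <= Q%:Z.
Proof.
exists `|Num.ceil (c / b)|%N => t j.
have c0 : 0 <= Num.ceil (c / b) by rewrite ceil_ge0 (@lt_trans _ _ 0) ?divr_gt0.
suff : hi t j <= lo t j + Num.ceil (c / b) by lia.
rewrite /win_hi /win_lo ceil_le_int rmorphD /=.
have -> : (j%:~R * a + c - t) / b = (j%:~R * a - t) / b + c / b by rewrite -mulrDl; congr (_ / _); ring.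
by apply: lerD; exact: ceil_ge.
Qed.

(** With [j = floor ((t + k b) / a)], the index [k] is lost between rows [j] and [j + 1]. Both row
    sums vanish and [z k != 0], so an index is gained, namely [hi t j], and [z] has the same value
    there. *)
Lemma null_next t (z : int -> R) (Q : nat) : (forall j, hi t j - lo t j <= Q%:Z) ->
  (forall j, Mmul a b c t z j = 0) ->
  forall k, z k != 0 -> exists k', [/\ k < k', k' <= k + Q%:Z & z k' != 0].
Proof.
move=> wQ z0 k zk; pose j := Num.floor ((t + k%:~R * b) / a).
have := floor_itv ((t + k%:~R * b) / a); rewrite -/j rmorphD /=.
rewrite ler_pdivlMr // ltr_pdivrMr // mulrDl mul1r => /andP[h1 h2].
have l1 : lo t j <= k.
  by rewrite /win_lo ceil_le_int ler_pdivrMr //; lra.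
have l2 : k < lo t (j + 1).
  by rewrite /win_lo ceil_gt_int ltr_pdivlMr // rmorphD /=; lra.
have kh : k < hi t j.
  by rewrite /win_hi ceil_gt_int ltr_pdivlMr //; have := ltab; have := ltbc; lra.
have [l3 l4] : lo t j = k /\ lo t (j + 1) = k + 1.
  move: l1 l2; case: (win_lo_step a_gt0 ltab t j) => ->; move: (lo t j) => l h1' h2'; split; lia.
exists (hi t j); split=> //; first by have := wQ j; lia.
have [X pX] := primitive_exists z.
have E : X (hi t (j + 1)) - X (k + 1) = X (hi t j) - X k.
  have := Mmul_primitive a_gt0 ltab ltbc t (j + 1) pX; rewrite z0 l4 => <-.
  by have := Mmul_primitive a_gt0 ltab ltbc t j pX; rewrite z0 l3.
move: E; rewrite pX; case: (win_hi_step c a_gt0 ltab t j) => ->; rewrite ?pX => E.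
  have /eqP : z k = 0 by lra.
  by rewrite (negbTE zk).
suff -> : z (hi t j) = z k by [].
by lra.
Qed.

(** Iterating [null_next] meets a nonzero entry, of square 1, within every [Q] steps to the
    right. *)
Lemma null_unbounded t (z : int -> R) (Q : nat) k0 : (forall j, hi t j - lo t j <= Q%:Z) ->
  (forall k, z k = -1 \/ z k = 0 \/ z k = 1) ->
  (forall j, Mmul a b c t z j = 0) -> z k0 != 0 ->
  forall n, n.+1%:R <= \sum_(i < (Q * n).+1) z (k0 + i%:Z) ^+ 2.
Proof.
move=> wQ zT z0 zk0 n; elim: n k0 zk0 => [|n IH] k zk.
  rewrite muln0 big_ord1 addr0.
  by case: (zT k) zk => [->|[->|->]]; rewrite ?eqxx ?sqrrN ?expr1n.
have [k' [kk' k'Q zk']] := null_next wQ z0 zk.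
have [d [dE dQ]] : exists d : nat, k' = k + d.+1%:Z /\ (d.+1 <= Q)%N.
  by exists (`|k' - k|%N.-1); lia.
have sq1 : z k ^+ 2 = 1.
  by case: (zT k) zk => [->|[->|->]]; rewrite ?eqxx ?sqrrN ?expr1n.
rewrite big_ord_recl addr0 sq1 -natr1 addrC lerD2l.
apply: le_trans (IH k' zk') _.
rewrite -(big_mkord xpredT (fun i => z (k' + i%:Z) ^+ 2)).
rewrite (eq_bigr (fun i : 'I_(Q * n.+1) => z (k + i.+1%:Z) ^+ 2)); last by move=> i _; rewrite lift0.
rewrite -(big_mkord xpredT (fun i => z (k + i.+1%:Z) ^+ 2)).
have le1 : (d <= Q * n.+1)%N by rewrite mulnS; lia.
have le2 : (d + (Q * n).+1 <= Q * n.+1)%N by rewrite mulnS; lia.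
rewrite [X in _ <= X](@big_cat_nat _ _ _ d) //=.
rewrite [X in _ <= _ + X](@big_cat_nat _ _ _ (d + (Q * n).+1)) //=; last by lia.
have s0 m1 m2 : 0 <= \sum_(m1 <= i < m2) z (k + i.+1%:Z) ^+ 2.
  by apply: sumr_ge0 => i _; exact: sqr_ge0.
rewrite addrCA ler_wpDr ?addr_ge0 //.
have -> (F : nat -> R) : \sum_(d <= i < d + (Q * n).+1) F i = \sum_(0 <= i < (Q * n).+1) F (i + d)%N.
  by rewrite -{1}[d]add0n [(d + _)%N]addnC big_addn addnK.
rewrite le_eqVlt; apply/orP; left; apply/eqP.
by apply: eq_bigr => i _; rewrite dE; congr (z _ ^+ 2); lia.
Qed.

Lemma right_gap (x : R) : exists2 e, 0 < e &
  forall t (m : int), x <= t < x + e -> (m%:~R * a <= t) = (m%:~R * a <= x).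
Proof.
have := floor_itv (x / a); set f := Num.floor _; rewrite rmorphD /=.
rewrite ler_pdivlMr // ltr_pdivrMr // mulrDl mul1r => /andP[h1 h2].
exists (f%:~R * a + a - x); first by lra.
move=> t m /andP[xt tx]; apply/idP/idP => h; last exact: le_trans xt.
apply: le_trans h1; rewrite ler_pM2r // ler_int.
have : (m%:~R < (f + 1)%:~R :> R) by rewrite -(ltr_pM2r a_gt0) rmorphD /= mulrDl mul1r; lra.
by rewrite ltr_int; lia.
Qed.

(** Half-open windows have right-continuous indicators, and [e] is uniform in [m] because the end
    points [m a] and [m a + c] form discrete sets. *)
Lemma chim_right_gap (x : R) : exists2 e, 0 < e &
  forall t (m : int), x <= t < x + e -> chim a c m t = chim a c m x.
Proof.
have [e1 e10 H1] := right_gap x; have [e2 e20 H2] := right_gap (x - c).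
exists (Num.min e1 e2); first by rewrite lt_min e10 e20.
move=> t m /andP[xt]; rewrite -ltrBlDl lt_min => /andP[t1 t2].
have E1 := H1 t m; have E2 := H2 (t - c) m.
rewrite /chim /ind E1; last by rewrite xt /=; lra.
by rewrite !ltNge -!lerBrDr E2 //; apply/andP; split; lra.
Qed.

Lemma chim_right_gaps (x : nat -> R) N : exists2 e, 0 < e & e <= b /\
  forall (i : 'I_N) t (m : int), x i <= t < x i + e -> chim a c m t = chim a c m (x i).
Proof.
elim: N => [|N [e e0 [eb H]]]; first by exists b => //; split => // -[].
have [e' e'0 H'] := chim_right_gap (x N).
exists (Num.min e e'); first by rewrite lt_min e0 e'0.
split; first by rewrite ge_min eb.
move=> i t m /andP[h1]; rewrite -ltrBlDl lt_min => /andP[h2 h3].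
have [iN|iN] := eqVneq (i : nat) N.
  by rewrite iN in h1 h3 *; apply: H'; rewrite h1 /=; lra.
have lt : (i < N)%N by have := ltn_ord i; lia.
by apply: (H (Ordinal lt)); rewrite /= h1 /=; lra.
Qed.

(* Test functions: [z] restricted to [N] consecutive indices, spread over
   cells [t0 + k b, t0 + k b + e[ so short that every row is constant on them. *)
Section TestFunction.
Variables (t0 : R) (z : int -> R) (k0 : int) (N : nat).
Let x (i : nat) : R := t0 + (k0 + i%:Z)%:~R * b.

Definition truncated (k : int) : R := if (k0 <= k) && (k < k0 + N%:Z) then z k else 0.

(** A window containing neither the first nor the last retained index sees either all of [z] or
    nothing, and its row vanishes. Any other row has at most [Q] entries of size at most 1. *)
Lemma Mmul_truncated_le (Q : nat) m : (forall j, hi t0 j - lo t0 j <= Q%:Z) -> (0 < N)%N ->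
  (forall k, z k = -1 \/ z k = 0 \/ z k = 1) ->
  (forall j, Mmul a b c t0 z j = 0) ->
  Mmul a b c t0 truncated m ^+ 2 <=
    Q%:R ^+ 2 * (chim a c m (x 0) + chim a c m (x N.-1)).
Proof.
move=> wQ N0 zT z0.
have chimx i : chim a c m (x i) = (lo t0 m <= k0 + i%:Z < hi t0 m)%R%:R.
  rewrite -(@chi_window R a b c a_gt0 ltab) -chimE; congr chi; rewrite /x; ring.
have truncated_norm k : `|truncated k| <= 1.
  rewrite /truncated; case: ifP => _; rewrite ?normr0 //.
  by case: (zT k) => [->|[->|->]]; rewrite ?normrN ?normr1 ?normr0.
have bound : `|Mmul a b c t0 truncated m| <= Q%:R.
  rewrite Mmul_sum //; apply: le_trans (ler_norm_sum _ _ _) _.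
  apply: (@le_trans _ _ (\sum_(i < `|hi t0 m - lo t0 m|%N) 1)).
    by apply: ler_sum => i _; exact: truncated_norm.
  rewrite sumr_const card_ord ler_nat.
  by have := wQ m; have := win_lo_le_hi a_gt0 ltab ltbc t0 m; lia.
have bound2 : Mmul a b c t0 truncated m ^+ 2 <= Q%:R ^+ 2.
  by rewrite -real_normK ?num_real // lerXn2r ?nnegrE.
rewrite !chimx addr0.
have [in0|out0] := boolP (lo t0 m <= k0 < hi t0 m)%R.
  apply: le_trans bound2 _; rewrite -[X in X <= _]mulr1 ler_wpM2l ?sqr_ge0 // lerDl ler0n //.
have [in1|out1] := boolP (lo t0 m <= k0 + N.-1%:Z < hi t0 m)%R.
  by apply: le_trans bound2 _; rewrite add0r mulr1.
rewrite addr0 mulr0.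
suff -> : Mmul a b c t0 truncated m = 0 by rewrite expr0n.
have lohi := win_lo_le_hi a_gt0 ltab ltbc t0 m.
have [inside|] := boolP ((k0 < lo t0 m) && (hi t0 m <= k0 + N.-1%:Z)).
  rewrite -(z0 m) !Mmul_sum //; apply: eq_bigr => i _; rewrite /truncated ifT //.
  by have := ltn_ord i; lia.
move=> outside; rewrite Mmul_sum // big1 // => i _; rewrite /truncated ifF //.
by have := ltn_ord i; lia.
Qed.

Variable e : R.
Hypotheses (e_gt0 : 0 < e) (e_le : e <= b).
Hypothesis He : forall (i : 'I_N) t (m : int),
  x i <= t < x i + e -> chim a c m t = chim a c m (x i).

Definition testfun (t : R) : R := \sum_(i < N) z (k0 + i%:Z) * ind (x i) (x i + e) t.

Lemma L2_testfun : L2real testfun.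
Proof. by apply: L2_sum => i; apply: L2Z; exact: L2_ind. Qed.

Lemma sqn_testfun : sqn testfun = e * \sum_(i < N) z (k0 + i%:Z) ^+ 2.
Proof.
have orth (i j : 'I_N) : ip (ind (x i) (x i + e)) (ind (x j) (x j + e)) =
    if i == j then e else 0.
  have [->|ij] := eqVneq i j.
    rewrite /ip; under eq_rint do rewrite ind_sqr.
    by rewrite rint_ind ?lerDl ?(ltW e_gt0) // addrAC subrr add0r.
  rewrite -[RHS]rint0; apply: eq_rint => t.
  have xx (i' j' : 'I_N) : (i' < j')%N -> x i' + e <= x j'.
    move=> lt; apply: (@le_trans _ _ (x i' + b)); first by rewrite lerD2l.
    rewrite /x -addrA lerD2l -[X in _ + X]mul1r -mulrDl ler_pM2r // -[1]/(1%:~R) -rmorphD /= ler_int.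
    by lia.
  rewrite /ind; case: (ltngtP i j) => [/xx h|/xx h|/val_inj/eqP]; last by rewrite (negbTE ij).
    case: (ltP t (x i + e)) => h1; rewrite ?andbF ?mul0r //.
    have -> : x j <= t = false by apply/negbTE; rewrite -ltNge; exact: lt_le_trans h.
    by rewrite mulr0.
  case: (ltP t (x j + e)) => h1; rewrite ?andbF ?mulr0 //.
  have -> : x i <= t = false by apply/negbTE; rewrite -ltNge; exact: lt_le_trans h.
  by rewrite mul0r.
have := @sqnorm_orthB R _ _ (fun=> e) (fun i => L2_ind _ _) orth _ (fun i => z (k0 + i%:Z)) (L20 R).
have -> : ip (fun=> 0) (fun=> 0) = 0 :> R.
  by rewrite -[RHS]rint0; apply: eq_rint => t; rewrite mulr0.
rewrite add0r => E; transitivity (\sum_(i < N) e * z (k0 + i%:Z) ^+ 2); last by rewrite mulr_sumr.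
rewrite (eq_bigr (fun i : 'I_N => e * z (k0 + i%:Z) ^+ 2)) in E; last first.
  move=> i _; rewrite (_ : ip _ _ = 0) ?mulr0 ?subr0 //.
  by rewrite -[RHS]rint0; apply: eq_rint => t; rewrite mul0r.
by rewrite -E; apply: eq_rint => t; rewrite sub0r mulrNN.
Qed.

(** The window is constant on each cell and [trigw] has period [b], so all cells carry the same
    integral and the coefficient factors. *)
Lemma gcoef_testfun ee m n : gcoef a b c ee testfun m n =
  Mmul a b c t0 truncated m * rint (fun t => ind t0 (t0 + e) t * trigw b ee n t).
Proof.
have iT p : intg (fun t => ind p (p + e) t * trigw b ee n t).
  by apply: (@intg_indM _ 1); [exact: measurable_trigw|exact: trigw_norm].
have -> : Mmul a b c t0 truncated m = \sum_(i < N) z (k0 + i%:Z) * chim a c m (x i).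
  pose s := [seq k0 + i%:Z | i <- index_iota 0 N].
  have us : uniq s by rewrite map_inj_uniq ?iota_uniq // => p q; lia.
  rewrite /Mmul -(@fsbig_widen _ _ _ _ [set` s]) //; last first.
    move=> k [_ /= ks]; rewrite /truncated; case: ifP => [kk|_]; last by rewrite mulr0.
    case: ks; apply/mapP; exists `|(k - k0)%R|%N; last by lia.
    by rewrite mem_index_iota; lia.
  rewrite -fsbig_seq // big_map big_mkord; apply: eq_bigr => i _.
  rewrite mulrC /truncated (_ : _ && _) ?lerDl ?ltrD2l; last by have := ltn_ord i; lia.
  by congr (_ * _); rewrite -chimE; congr chi; rewrite /x; ring.
rewrite mulr_suml /gcoef ip_suml; last 2 first.
- by move=> i; apply: L2Z; exact: L2_ind.
- exact: L2_chim_trigw.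
apply: eq_bigr => i _; rewrite -mulrA ipZl; last 2 first.
- exact: L2_ind.
- exact: L2_chim_trigw.
congr (_ * _).
rewrite -(rint_shift (- ((k0 + i%:Z)%:~R * b)) (iT t0)) -rintZ; last exact: intg_shift (iT t0).
apply: eq_rint => t.
have -> : ind t0 (t0 + e) (t - (k0 + i%:Z)%:~R * b) = ind (x i) (x i + e) t.
  rewrite -(ind_shift _ _ ((k0 + i%:Z)%:~R * b)) subrK /x; congr ind; ring.
have -> : trigw b ee n (t - (k0 + i%:Z)%:~R * b) = trigw b ee n t.
  have := trigw_period b_gt0 n (- (k0 + i%:Z)) t; rewrite rmorphN /= mulNr => -[h1 h2].
  by rewrite /trigw h1 h2.
rewrite {1 2}/ind; case: (boolP ((x i <= t) && (t < x i + e))) => [h|_].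
  by rewrite (He _ h); ring.
by rewrite !mul0r mulr0.
Qed.

(** Bessel is applied to a single cell, of squared norm [e]. The bound is linear in [e], like the
    squared norm of [testfun], so the cell length cancels in the comparison. *)
Lemma gsum_testfun M : (forall s : seq int, uniq s ->
    \sum_(m <- s) Mmul a b c t0 truncated m ^+ 2 <= M) ->
  (gsum a b c testfun <= (2 * (b * e) * M)%:E)%E.
Proof.
move=> HM.
have inner m : (\esum_(n in [set: int]) (gcoef2 a b c testfun m n)%:E <=
    (2 * (Mmul a b c t0 truncated m ^+ 2 * (b * e)))%:E)%E.
  apply: esum_even_le => [n|n|K]; [exact: gcoef2_ge0|apply: gcoef2N; exact: L2_testfun|].
  rewrite (eq_bigr (fun n : 'I_K => Mmul a b c t0 truncated m ^+ 2 *
     wcoef2 b t0 1 (ind t0 (t0 + e)) n)); last first.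
    move=> n _; rewrite /gcoef2 !gcoef_testfun !exprMn -mulrDr; congr (_ * _).
    have ie t : ind t0 (t0 + 1 * b) t * ind t0 (t0 + e) t = ind t0 (t0 + e) t.
      rewrite mul1r /ind; case: (t0 <= t); rewrite /= ?mulr0 //.
      case: (ltP t (t0 + e)) => h; rewrite ?mulr0 //.
      by rewrite (lt_le_trans h) ?mulr1 // lerD2l.
    by rewrite /wcoef2; congr (_ ^+ 2 + _ ^+ 2); apply: eq_rint => t; rewrite -[in LHS]ie; ring.
  rewrite -mulr_sumr ler_wpM2l ?sqr_ge0 //.
  apply: le_trans (bessel_trig b_gt0 t0 K (isT : (0 < 1)%N) (L2_ind _ _)) _.
  rewrite mul1r ler_wpM2l ?(ltW b_gt0) //.
  have eE : rint (ind t0 (t0 + e)) = e.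
    by rewrite rint_ind ?lerDl ?(ltW e_gt0) // addrAC subrr add0r.
  rewrite -[X in _ <= X]eE; apply: le_rint.
  - by apply: L2_mul; apply: L2_ind0M; exact: L2_ind.
  - exact: intg_ind.
  - move=> t; rewrite mulrACA !ind_sqr -[X in _ <= X]mul1r ler_wpM2r ?ind_ge0 //.
    by apply: le_trans (ler_norm _) (ind_norm _ _ _).
apply: le_trans (le_esum _) _; first by move=> m _; exact: inner.
apply: esum_le_seq => s us; rewrite -mulr_sumr -mulrA ler_wpM2l //.
rewrite -mulr_suml mulrC ler_wpM2l ?HM // mulr_ge0 ?ltW //.
Qed.

End TestFunction.

Lemma frame_null_trivial : gabor_frame (chi c) a b -> null_trivial a b c.
Proof.
move=> /gabor_frame_real[A [B [A0 [_ H]]]] t0 z zT z0 k0.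
apply: contrapT => /eqP zk0.
have [Q wQ] := window_size; have [P HP] := chim_count a_gt0 ltab ltbc.
(* Each of the two ends of the truncation lies in at most [P] windows, so [M] does not grow with the
   length [N]. *)
pose M := Q%:R ^+ 2 * (P%:R + P%:R) : R.
(* The frame bound will give [A * S <= 2 b M] for the sum [S] of squared entries, whereas
   [S >= n + 1]. The cell length [e] is chosen only after [N]. *)
pose n := Num.bound (2 * b * M / A).
pose N := (Q * n).+1.
have [e e0 [eb He]] := chim_right_gaps (fun i => t0 + (k0 + i%:Z)%:~R * b) N.
have [lower _] := H _ (L2_testfun t0 z k0 N e).
have M0 : 0 <= M by rewrite mulr_ge0 ?sqr_ge0 ?addr_ge0.
have upper : (gsum a b c (testfun t0 z k0 N e) <= (2 * (b * e) * M)%:E)%E.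
  apply: gsum_testfun => // s us.
  apply: (@le_trans _ _ (\sum_(m <- s) Q%:R ^+ 2 *
      (chim a c m (t0 + (k0 + 0%:Z)%:~R * b) + chim a c m (t0 + (k0 + N.-1%:Z)%:~R * b)))).
    by apply: ler_sum => m _; apply: Mmul_truncated_le => //; exact: wQ.
  rewrite -mulr_sumr ler_wpM2l ?sqr_ge0 // big_split /=.
  by apply: lerD; exact: HP.
have := le_trans lower upper; rewrite lee_fin sqn_testfun // => h.
have := null_unbounded (wQ t0) zT z0 zk0 n; rewrite -/N.
move: h; set S := \sum_(i < N) _ => h Sn.
have Ab : A * S <= 2 * b * M.
  rewrite -(ler_pM2l e0); apply: le_trans (_ : A * (e * S) <= _).
    by rewrite mulrCA.
  by apply: le_trans h _; rewrite le_eqVlt; apply/orP; left; apply/eqP; ring.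
have nb : 2 * b * M / A < n%:R.
  by apply: archi_boundP; rewrite divr_ge0 ?mulr_ge0 ?(ltW b_gt0) ?(ltW A0).
rewrite ltr_pdivrMr // in nb; rewrite -natr1 in Sn.
have : A * (n%:R + 1) <= A * S by rewrite ler_pM2l.
by rewrite mulrDr mulr1 [A * n%:R]mulrC; lra.
Qed.

End FrameNull.

Theorem theorem3p2 (R : realType) (a b c : R) :
  0 < a -> a < b -> b < c ->
  (gabor_frame (chi c) a b <->
     (forall (t : R) (z : int -> R),
        (forall k, z k = -1 \/ z k = 0 \/ z k = 1) ->
        (forall j, Mmul a b c t z j = 0) ->
        forall k, z k = 0)) /\
  ((forall (t : R) (z : int -> R),
        (forall k, z k = -1 \/ z k = 0 \/ z k = 1) ->
        (forall j, Mmul a b c t z j = 0) ->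
        forall k, z k = 0) <->
     Dset a b c = set0).
Proof.
move=> a_gt0 ltab ltbc; split; last exact: null_trivial_Dset0.
by split; [exact: frame_null_trivial|exact: null_trivial_frame].
Qed.
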